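(* Let $X$ be a compact metric space, $r:X\to X$ a finite-to-one, onto, Borel measurable map, $\mu$ a strongly invariant Borel probability measure on $X$ such that $r$ is ergodic with respect to $\mu$, and $m_0$ a quadrature mirror filter on $X$ such that $|m_0|$ is not $\mu$-a.e. equal to the constant $1$, $\mu(\{x: m_0(x)=0\})=0$, and $\log|m_0|^2\in L^1(X,\mu)$. Then there exists a fundamental domain $\mathcal{F}\subseteq X_\infty$ for $r_\infty$, and the wavelet representation $(L^2(X_\infty,\mu_\infty),U,\pi)$ has the direct integral decomposition $$[L^2(\mu_\infty),U,\pi]=\int_{\mathcal{F}}^\oplus[\mathcal{H}_z,U_z,\pi_z]\,d\mu_\infty(z),$$ i.e. there is a unitary operator $\Psi:L^2(X_\infty,\mu_\infty)\to\int_{\mathcal F}^\oplus\mathcal H_z\,d\mu_\infty(z)$ intertwining $U$ with $\int^\oplus U_z$ and $\pi(f)$ with $\int^\oplus\pi_z(f)$ for all $f\in L^\infty(X)$; moreover the component representations $[\mathcal{H}_z,U_z,\pi_z]$ are irreducible for $\mu_\infty$-a.e. $z\in\mathcal{F}$.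
   Context: Strong invariance of $\mu$ means $\int f\,d\mu=\int\frac{1}{\#r^{-1}(x)}\sum_{r(y)=x}f(y)\,d\mu(x)$ for every bounded Borel $f$. A quadrature mirror filter is a Borel $m_0:X\to\mathbb{C}$ with $\frac{1}{\#r^{-1}(x)}\sum_{r(y)=x}|m_0(y)|^2=1$ for all $x$. Put $W(x)=|m_0(x)|^2/\#r^{-1}(r(x))$. Solenoid: $X_\infty=\{(x_0,x_1,\dots)\in X^{\mathbb N}: r(x_{n+1})=x_n\ \forall n\ge0\}$ with the cylinder $\sigma$-algebra; $r_\infty(x_0,x_1,\dots)=(r(x_0),x_0,x_1,\dots)$ (a measurable automorphism with inverse the left shift); $\theta_0(x_0,x_1,\dots)=x_0$. For $x\in X$, $\Omega_x=\{(x_n)\in X_\infty:x_0=x\}$ carries the probability measure $P_x$ with $P_x(x_1=z_1,\dots,x_n=z_n)=W(z_1)\cdots W(z_n)$; $\mu_\infty$ is defined by $\int f\,d\mu_\infty=\int_X\int_{\Omega_x}f\,dP_x\,d\mu(x)$. The wavelet representation is realized on $L^2(X_\infty,\mu_\infty)$ by $U\xi=(m_0\circ\theta_0)\,\xi\circ r_\infty$ and $\pi(f)\xi=(f\circ\theta_0)\xi$ for $f\in L^\infty(X)$. A fundamental domain is a measurable $\mathcal F\subseteq X_\infty$ with, up to $\mu_\infty$-null sets, $\bigcup_{n\in\mathbb Z}r_\infty^n(\mathcal F)=X_\infty$ and $r_\infty^n(\mathcal F)\cap r_\infty^m(\mathcal F)=\emptyset$ for $n\ne m$. Define $\tilde m_0=1$,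 $\tilde m_n=\prod_{k=0}^{n-1}m_0\circ\theta_0\circ r_\infty^k$ for $n\ge1$, $\tilde m_n=1/\prod_{k=n}^{-1}m_0\circ\theta_0\circ r_\infty^{k}$ for $n<0$. For $z\in X_\infty$ with all $\tilde m_n(z)\neq0$ (a $\mu_\infty$-conull set), $\mathcal H_z=\{(\xi_n)_{n\in\mathbb Z}:\sum_n|\xi_n|^2|\tilde m_n(z)|^2<\infty\}$ with $\langle\xi,\eta\rangle=\sum_n\xi_n\overline{\eta_n}|\tilde m_n(z)|^2$; $U_z(\xi_n)_n=(m_0(\theta_0(r_\infty^n z))\,\xi_{n+1})_n$; $\pi_z(f)(\xi_n)_n=(f(\theta_0(r_\infty^nz))\,\xi_n)_n$ for bounded Borel $f$ on $X$. *)

(* Defs.v *)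
From HB Require Import structures.
From mathcomp Require Import all_boot all_order all_algebra.
From mathcomp Require Import all_classical all_reals all_analysis.
From mathcomp.real_closed Require Import complex.

Set Implicit Arguments.
Unset Strict Implicit.
Unset Printing Implicit Defensive.

Import Order.TTheory GRing.Theory Num.Theory.
Import numFieldNormedType.Exports.

Local Open Scope classical_set_scope.
Local Open Scope ring_scope.

Definition csq {R : realType} (z : R[i]) : R := (complex.Re z) ^+ 2 + (complex.Im z) ^+ 2.

Notation Borel X := (g_sigma_algebraType (@open X)).

Definition cmeasurable {d} {T : measurableType d} {R : realType}
  (D : set T) (f : T -> R[i]) : Prop :=
  measurable_fun D (fun x => complex.Re (f x)) /\
  measurable_fun D (fun x => complex.Im (f x)).

Definition bounded_cmeas {d} {T : measurableType d} {R : realType}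
  (f : T -> R[i]) : Prop :=
  cmeasurable setT f /\ exists M : R, forall x, csq (f x) <= M.

Section Solenoid.
Context {d : measure_display} {X : measurableType d}.

Definition cylinder_gen : set (set (nat -> X)) :=
  [set B | exists n (A : set X), measurable A /\ B = (fun s => s n) @^-1` A].

End Solenoid.

Notation Seq X := (g_sigma_algebraType (@cylinder_gen _ X)).

Section Solenoid2.
Context {d : measure_display} {X : measurableType d}.

Variable r : X -> X.

Definition Xinf : set (Seq X) := [set s | forall n, r (s n.+1) = s n].

Definition theta0 (s : Seq X) : X := s 0%N.

Definition rinf (s : Seq X) : Seq X := fun n => if n is k.+1 then s k else r (s 0%N).
Definition shift (s : Seq X) : Seq X := fun n => s n.+1.

Definition rinf_pow (k : int) (s : Seq X) : Seq X :=
  match k with Posz n => iter n rinf s | Negz n => iter n.+1 shift s end.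

Definition rz (k : int) (z : Seq X) : X := theta0 (rinf_pow k z).

(* r_infty^n (F), as a subset of X_infty (r_infty is a bijection of X_infty) *)
Definition rinf_image (n : int) (F : set (Seq X)) : set (Seq X) :=
  [set z | Xinf z /\ F (rinf_pow (- n) z)].

End Solenoid2.

Section Filters.
Context {d : measure_display} {X : measurableType d} {R : realType}.
Variable r : X -> X.

Definition fibre (x : X) : set X := r @^-1` [set x].

Definition Nfib (x : X) : R := \sum_(y \in fibre x) (1 : R).

Definition strongly_invariant (mu : {measure set X -> \bar R}) : Prop :=
  forall f : X -> R, measurable_fun setT f -> (exists M, forall x, `|f x| <= M) ->
  (\int[mu]_x (f x)%:E =
   \int[mu]_x ((Nfib x)^-1 * \sum_(y \in fibre x) f y)%:E)%E.

Definition ergodic (mu : {measure set X -> \bar R}) : Prop :=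
  forall A : set X, measurable A -> r @^-1` A = A -> mu A = 0%E \/ mu A = 1%E.

Definition QMF (m0 : X -> R[i]) : Prop :=
  cmeasurable setT m0 /\
  forall x, (Nfib x)^-1 * \sum_(y \in fibre x) csq (m0 y) = 1.

Variable m0 : X -> R[i].

Definition W (x : X) : R := csq (m0 x) / Nfib (r x).

(* cw n A x = P_x(x_1 in A 1, ..., x_n in A n)
            = sum over paths x <- z_1 <- ... <- z_n of W(z_1)...W(z_n) 1_{A_1}(z_1)...1_{A_n}(z_n) *)
Fixpoint cw (n : nat) (A : nat -> set X) (x : X) : R :=
  match n with
  | 0%N => 1
  | n'.+1 => \sum_(y \in fibre x) (W y * \1_(A 1%N) y * cw n' (fun k => A k.+1) y)
  end.

Definition is_solenoid_measure (mu : {measure set X -> \bar R})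
  (mu_inf : {measure set (Seq X) -> \bar R}) : Prop :=
  mu_inf.-negligible (~` Xinf r) /\
  forall (n : nat) (A : nat -> set X), (forall k, measurable (A k)) ->
    mu_inf [set s : Seq X | forall k, (k <= n)%N -> A k (s k)] =
    (\int[mu]_x (\1_(A 0%N) x * cw n A x)%:E)%E.

Definition mtilde (n : int) (z : Seq X) : R[i] :=
  match n with
  | Posz k => \prod_(0 <= j < k) m0 (rz r j%:Z z)
  | Negz k => (\prod_(1 <= j < k.+2) m0 (z j))^-1
  end.

Definition hnorm2 (z : Seq X) (xi : int -> R[i]) : \bar R :=
  (\esum_(n in [set: int]) (csq (xi n) * csq (mtilde n z))%:E)%E.

Definition Hz (z : Seq X) : set (int -> R[i]) := [set xi | (hnorm2 z xi < +oo)%E].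

Definition Uz (z : Seq X) (xi : int -> R[i]) : int -> R[i] :=
  fun n => m0 (rz r n z) * xi (n + 1).

Definition piz (z : Seq X) (f : X -> R[i]) (xi : int -> R[i]) : int -> R[i] :=
  fun n => f (rz r n z) * xi n.

(* [H_z, U_z, pi_z] is irreducible: the only closed subspaces of H_z invariant
   under U_z, U_z^* = U_z^{-1} and all pi_z(f) are {0} and H_z. *)
Definition irreducible_fibre (z : Seq X) : Prop :=
  forall K : set (int -> R[i]),
    K `<=` Hz z ->
    K (fun=> 0) ->
    (forall xi eta, K xi -> K eta -> K (fun n => xi n + eta n)) ->
    (forall (a : R[i]) xi, K xi -> K (fun n => a * xi n)) ->
    (forall xi, Hz z xi ->
       (forall e : R, 0 < e -> exists2 eta, K eta &
           (hnorm2 z (fun n => (xi n - eta n)%R) < e%:E)%E) -> K xi) ->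
    (forall xi, Hz z xi -> (K (Uz z xi) <-> K xi)) ->
    (forall f xi, bounded_cmeas f -> K xi -> K (piz z f xi)) ->
    K `<=` [set fun=> 0] \/ Hz z `<=` K.

Variable mu_inf : {measure set (Seq X) -> \bar R}.

Definition L2 : set (Seq X -> R[i]) :=
  [set xi | cmeasurable setT xi /\ (\int[mu_inf]_s (csq (xi s))%:E < +oo)%E].

Definition Uop (xi : Seq X -> R[i]) : Seq X -> R[i] :=
  fun s => m0 (theta0 s) * xi (rinf r s).

Definition piop (f : X -> R[i]) (xi : Seq X -> R[i]) : Seq X -> R[i] :=
  fun s => f (theta0 s) * xi s.

Definition DI (F : set (Seq X)) : set (Seq X -> int -> R[i]) :=
  [set eta | (forall n, cmeasurable F (fun z => eta z n)) /\
             (\int[mu_inf]_(z in F) hnorm2 z (eta z) < +oo)%E].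

Definition DIeq (F : set (Seq X)) (eta eta' : Seq X -> int -> R[i]) : Prop :=
  {ae mu_inf, forall z, F z -> forall n, eta z n = eta' z n}.

Definition fundamental_domain (F : set (Seq X)) : Prop :=
  measurable F /\ F `<=` Xinf r /\
  mu_inf.-negligible (Xinf r `\` \bigcup_(n in [set: int]) rinf_image r n F) /\
  (forall n m : int, n != m -> mu_inf.-negligible (rinf_image r n F `&` rinf_image r m F)).

Definition decomposes (F : set (Seq X)) (Psi : (Seq X -> R[i]) -> (Seq X -> int -> R[i])) : Prop :=
  (forall xi, L2 xi -> DI F (Psi xi)) /\
  (forall (a : R[i]) xi zeta, L2 xi -> L2 zeta ->
      DIeq F (Psi (fun s => a * xi s + zeta s)) (fun z n => a * Psi xi z n + Psi zeta z n)) /\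
  (forall xi, L2 xi ->
      (\int[mu_inf]_(z in F) hnorm2 z (Psi xi z) = \int[mu_inf]_s (csq (xi s))%:E)%E) /\
  (forall eta, DI F eta -> exists2 xi, L2 xi & DIeq F (Psi xi) eta) /\
  (forall xi, L2 xi -> DIeq F (Psi (Uop xi)) (fun z => Uz z (Psi xi z))) /\
  (forall f xi, bounded_cmeas f -> L2 xi ->
      DIeq F (Psi (piop f xi)) (fun z => piz z f (Psi xi z))).

End Filters.

(* Main.v *)
(* Write h = |m0|^2, T = r_infty, and w_n(z) = |mtilde_n(z)|^2, so that w_n is the
   density of mu_infty under T^n.  The integral of ln h is strictly negative, because
   ln t <= t - 1 with equality only at t = 1 and h has integral 1.  By the maximal
   ergodic argument the Birkhoff sums of ln h tend to -oo linearly, so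
   s(x) = sum_(n >= 0) h(x) h(r x) ... h(r^(n-1) x) is finite almost everywhere.
   On A_M = {s <= M} one has sum_n mu_infty(z_n in A_M) = int_(z_0 in A_M) s <= M, and by
   Borel-Cantelli almost every backward orbit leaves A_M for good.  Taking on each orbit
   the first visit to the A_M of least index gives the fundamental domain F, and
   (Psi xi)(z)_n = xi(T^n z) is the unitary.
   Divergence of s along periodic orbits, where h = 1, shows that almost no point is
   periodic; hence the points theta_0(T^n z) are distinct, the pi_z(f) contain the
   coordinate projections of H_z, and U_z links the coordinates: H_z is irreducible. *)
From Pilot Require Import Defs.
From HB Require Import structures.
From mathcomp Require Import all_boot all_order all_algebra.
From mathcomp Require Import all_classical all_reals all_analysis.
From mathcomp.real_closed Require Import complex.
From mathcomp Require Import measurable_realfun.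
From mathcomp Require Import ring lra zify.
Import Order.TTheory GRing.Theory Num.Theory.
Import numFieldNormedType.Exports.
Local Open Scope classical_set_scope.
Local Open Scope ring_scope.
Set Implicit Arguments.
Unset Strict Implicit.
Unset Printing Implicit Defensive.

(** * Lower integrals and densities *)

(** The recurring obstacle is measurability. Fibre averages and the path weights [cw] are finite
    sums over fibres of [r] that are not known here to be Borel. The way out is that each such
    function agrees almost everywhere with a Borel one of the right integral; strong invariance
    gives this because it applies to f and 1 - f alike.

    The solenoid measure is known only through its cylinder values. Its dynamics is drawn from one
    consequence: its image under the inverse of r_infty has density h at the zeroth coordinate.
    Invariance of null sets in both directions, the densities w_n and the isometry all follow.

    Disjointness of the translates of F does not give irreducibility: a non-periodic point of the
    solenoid can have a periodic coordinate, and then two base points on its orbit coincide. Hence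
    aperiodicity is proved for [r] on X itself. *)

Section NonmeasurableIntegral.
Local Open Scope ereal_scope.
Context d (T : measurableType d) (R : realType) (mu : {measure set T -> \bar R}).
Import HBNNSimple.

Lemma aeS (P Q : T -> Prop) : {ae mu, forall x, P x} ->
  (forall x, P x -> Q x) -> {ae mu, forall x, Q x}.
Proof. by move=> Pmu PQ; apply: filterS Pmu. Qed.

Lemma aeS2 (P Q S : T -> Prop) : {ae mu, forall x, P x} -> {ae mu, forall x, Q x} ->
  (forall x, P x -> Q x -> S x) -> {ae mu, forall x, S x}.
Proof. by move=> Pmu Qmu PQ; apply: filterS2 Pmu Qmu. Qed.

Lemma integral_indicT (A : set T) : measurable A -> \int[mu]_x (\1_A x)%:E = mu A.
Proof. by move=> mA; rewrite integral_indic// setIT. Qed.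

Lemma le_lower_integral (f g : T -> \bar R) :
  (forall x, 0 <= f x) -> (forall x, f x <= g x) ->
  \int[mu]_x f x <= \int[mu]_x g x.
Proof.
move=> f0 fg; have g0 x : 0 <= g x by exact: le_trans (fg x).
rewrite !ge0_integralTE//; apply: ereal_sup_le => _ [h/= hf <-].
by exists h => // x; exact: le_trans (fg x).
Qed.

(* The integral of a non-negative, possibly non-measurable, function is a lower
   integral, and it is attained by a measurable minorant. *)
Lemma lower_envelope (f : T -> \bar R) :
  (forall x, 0 <= f x) -> \int[mu]_x f x < +oo ->
  exists g : T -> \bar R, [/\ measurable_fun setT g, forall x, 0 <= g x,
    forall x, g x <= f x & \int[mu]_x g x = \int[mu]_x f x].
Proof.
move=> f0 foo.
have ffin : \int[mu]_x f x \is a fin_num by rewrite ge0_fin_numE// integral_ge0.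
have /choice[h hP] : forall n : nat, exists h : {nnsfun T >-> R},
    (forall x, (h x)%:E <= f x) /\ \int[mu]_x f x - (n.+1%:R^-1)%:E < \int[mu]_x (h x)%:E.
  move=> n; have := ffin; rewrite {1 2}ge0_integralTE// => ffin'.
  have n0 : (0 < n.+1%:R^-1 :> R)%R by rewrite invr_gt0.
  have [_ [h /= hf <-] hn] := ub_ereal_sup_adherent n0 ffin'.
  by exists h; split => //; rewrite integralT_nnsfun.
pose g x := esups (fun n => (h n x)%:E) 0%N.
have hg n x : (h n x)%:E <= g x by apply: ereal_sup_ubound; exists n.
have gf x : g x <= f x.
  by apply: ge_ereal_sup => _ [n _ <-]; exact: (hP n).1.
have g0 x : 0 <= g x by apply: le_trans (hg 0%N x); rewrite lee_fin.
have mg : measurable_fun setT g.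
  apply: measurable_fun_esups => n; apply/measurable_EFinP.
  exact: measurable_funP.
exists g; split => //; apply/eqP; rewrite eq_le; apply/andP; split.
  exact: le_lower_integral.
apply/lee_addgt0Pr => e e0.
have [n] := ltr_add_invr e0; rewrite add0r => ne.
rewrite -leeBlDr//; apply: le_trans (le_trans (ltW (hP n).2) _).
  by rewrite leeB// lee_fin ltW.
by apply: le_lower_integral => // x; rewrite lee_fin.
Qed.

(** Off a null set a simple minorant of [f] is also one of [g], and a null set does not affect the
    integral of a measurable function. This exchanges a non-measurable integrand for a measurable
    version. *)
Lemma ae_eq_lower_integral (f g : T -> \bar R) : measurable_fun setT g ->
  (forall x, 0 <= f x) -> (forall x, 0 <= g x) ->
  {ae mu, forall x, f x = g x} -> \int[mu]_x f x = \int[mu]_x g x.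
Proof.
move=> mg f0 g0 [N [mN N0 fgN]].
have fg x : ~ N x -> f x = g x by move=> Nx; apply: contrapT => /fgN.
have mr (u : T -> \bar R) : measurable_fun setT u -> measurable_fun setT (u \_ (~` N)).
  by move=> mu'; apply/(measurable_restrictT _ _).1; [exact: measurableC|exact: measurable_funTS].
have r0 (u : T -> \bar R) x : (forall x, 0 <= u x) -> 0 <= (u \_ (~` N)) x.
  by move=> u0; rewrite patchE; case: ifPn.
have rE (u : T -> \bar R) : measurable_fun setT u -> (forall x, 0 <= u x) ->
    \int[mu]_x u x = \int[mu]_x (u \_ (~` N)) x.
  move=> mu' u0; rewrite (ge0_negligible_integral mN)//.
  by rewrite setTD integral_mkcond.
apply/eqP; rewrite eq_le; apply/andP; split.
  rewrite ge0_integralTE//; apply: ge_ereal_sup => _ [h/= hf <-].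
  rewrite -integralT_nnsfun rE//; last 2 first.
    exact/measurable_EFinP/measurable_funP.
  by move=> x; rewrite lee_fin.
  apply: le_lower_integral => x.
    by apply: r0 => {}x; rewrite lee_fin.
  rewrite patchE; case: ifPn => //; rewrite inE => Nx.
  by rewrite -fg.
rewrite rE//; apply: le_lower_integral => x; first exact: r0.
by rewrite patchE; case: ifPn => //; rewrite inE => Nx; rewrite fg.
Qed.

Lemma ae_eq_of_le_integral (f g : T -> \bar R) :
  measurable_fun setT f -> measurable_fun setT g ->
  (forall x, 0 <= f x) -> (forall x, f x <= g x) -> \int[mu]_x g x < +oo ->
  \int[mu]_x f x = \int[mu]_x g x -> {ae mu, forall x, f x = g x}.
Proof.
move=> mf mg f0 fg goo fgE.
have g0 x : 0 <= g x by exact: le_trans (fg x).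
have ig : mu.-integrable setT g.
  by apply/integrableP; split => //; under eq_integral do rewrite gee0_abs//.
have if_ : mu.-integrable setT f.
  apply: le_integrable ig => // x _; rewrite !gee0_abs//.
have : \int[mu]_x (g x - f x) = 0.
  by rewrite integralB// fgE subee// ge0_fin_numE// integral_ge0.
have gf0 x : f x \is a fin_num -> 0 <= g x - f x by move=> fx; rewrite sube_ge0 ?fx.
have aef := integrable_ae measurableT if_.
move=> gf; have : \int[mu]_x `|g x - f x| = 0.
  rewrite -gf; apply: ae_eq_integral => //.
  - by apply: measurableT_comp => //; exact: emeasurable_funB.
  - exact: emeasurable_funB.
  - by apply: filterS aef => x fx _; rewrite gee0_abs// gf0// fx.
move=> /(ae_eq_integral_abs _ measurableT _).1 /=.
move=> /(_ (emeasurable_funB mg mf)) H.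
have aeg := integrable_ae measurableT ig.
near=> x; have fx : f x \is a fin_num by near: x; apply: filterS aef => x; exact.
have gx : g x \is a fin_num by near: x; apply: filterS aeg => x; exact.
have : (g x - f x = 0) by near: x; apply: filterS H => x; exact.
by move=> /eqP; rewrite sube_eq ?add0e ?fin_num_adde_defl// => /eqP.
Unshelve. all: by end_near. Qed.

Lemma integral_density (nu : {measure set T -> \bar R}) (c : T -> R) :
  measurable_fun setT c -> (forall x, 0 <= c x)%R ->
  (forall A, measurable A -> nu A = \int[mu]_(x in A) (c x)%:E) ->
  forall f : T -> \bar R, measurable_fun setT f -> (forall x, 0 <= f x) ->
  \int[nu]_x f x = \int[mu]_x (f x * (c x)%:E).
Proof.
move=> mc c0 nuE f mf f0.
pose f_ := nnsfun_approx measurableT mf.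
have mf_ n : measurable_fun setT (EFin \o f_ n).
  exact/measurable_EFinP/measurable_funP.
have cf_ x : (f_ n x)%:E @[n --> \oo] --> f x by exact: cvg_nnsfun_approx.
transitivity (limn (fun n => \int[nu]_x (f_ n x)%:E)).
  rewrite -monotone_convergence//.
  - by apply: eq_integral => y _; apply/esym/cvg_lim => //; exact: cf_.
  - by move=> n y _; rewrite lee_fin.
  - by move=> y _ m n mn; rewrite lee_fin; exact/lefP/nd_nnsfun_approx.
rewrite [X in limn X](_ : _ =
    (fun n => \int[mu]_x ((f_ n x)%:E * (c x)%:E))); last first.
  apply/funext => n.
  transitivity (\sum_(k \in range (f_ n)) \int[nu]_x (k * \1_(f_ n @^-1` [set k]) x)%:E).
    rewrite -ge0_integral_fsum//; first last.
    - by move=> r x _; rewrite nnfun_muleindic_ge0.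
    - by move=> r; exact/measurable_EFinP/measurable_funM.
    by apply: eq_integral => x _; rewrite fimfunE -fsumEFin.
  transitivity (\sum_(k \in range (f_ n))
      \int[mu]_x ((k * \1_(f_ n @^-1` [set k]) x)%:E * (c x)%:E)).
    apply: eq_fsbigr => r; rewrite inE => -[t _ rE].
    have r0 : (0 <= r)%R by rewrite -rE.
    rewrite integralZl_indic_nnsfun// integral_indic// setIT nuE//.
    under [RHS]eq_integral do rewrite EFinM -muleA.
    rewrite ge0_integralZl//; last 2 first.
    - by apply: emeasurable_funM => //; exact/measurable_EFinP.
    - by move=> x _; rewrite mule_ge0// lee_fin.
    rewrite integral_mkcond epatch_indic; congr (_ * _).
    by apply: eq_integral => x _; rewrite muleC.
  rewrite -ge0_integral_fsum//; first last.
  - by move=> r x _; apply: mule_ge0; [rewrite EFinM nnfun_muleindic_ge0|rewrite lee_fin].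
  - move=> r; apply: emeasurable_funM => //; last exact/measurable_EFinP.
    exact/measurable_EFinP/measurable_funM.
  apply: eq_integral => x _; rewrite [in RHS]fimfunE -fsumEFin//.
  by rewrite ge0_mule_fsuml// => r; rewrite nnfun_muleindic_ge0.
rewrite -monotone_convergence//.
- apply: eq_integral => x _; apply/cvg_lim => //.
  by rewrite muleC; under eq_fun do rewrite muleC; apply: cvgeZl => //; exact: cf_.
- by move=> n; apply: emeasurable_funM => //; exact/measurable_EFinP.
- by move=> n x _; rewrite mule_ge0// lee_fin.
- by move=> x _ m n mn; rewrite lee_wpmul2r ?lee_fin//; exact/lefP/nd_nnsfun_approx.
Qed.
End NonmeasurableIntegral.

Lemma nneseries_telescope (R : realType) (u : nat -> R) (a : R) (N : nat) :
  u 0%N = 0 -> (forall n, (N <= n)%N -> u n = a) ->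
  (\sum_(k <oo) (u k.+1 - u k)%:E = a%:E)%E.
Proof.
move=> u0 uN; apply: cvg_lim => //; apply: cvg_near_cst.
exists N => //= n /= Nn.
rewrite sumEFin; congr (_%:E).
by rewrite telescope_sumr// u0 subr0 uN.
Qed.

(** The transfer operator of [r] with uniform weights. Strong invariance says that it preserves
    integrals against [mu], the filter equation that it sends |m0|^2 to the constant 1. *)
Definition fibre_average {d} {X : measurableType d} {R : realType} (r : X -> X)
  (f : X -> R) (x : X) : R := (Nfib r x)^-1 * \sum_(y \in fibre r x) f y.

(** * Averages over the fibres of r *)

Section FibreAverage.
Context d (X : measurableType d) (R : realType) (r : X -> X).
Hypothesis r_finite : forall x, finite_set (fibre r x).
Hypothesis r_onto : forall x, exists y, r y = x.
Local Notation avg := (@fibre_average _ X R r).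

Lemma Nfib_gt0 x : 0 < Nfib r x :> R.
Proof.
have [y yx] := r_onto x; rewrite /Nfib (fsbigD1 y)//= ltr_pwDl//.
by apply: fsumr_ge0.
Qed.

Lemma eq_fibre_average (f g : X -> R) x :
  (forall y, r y = x -> f y = g y) -> avg f x = avg g x.
Proof.
by move=> fg; congr (_ * _); apply: eq_fsbigr => y; rewrite inE => /fg.
Qed.

Lemma fibre_averageD (f g : X -> R) x :
  avg (fun y => f y + g y) x = avg f x + avg g x.
Proof. by rewrite /fibre_average fsbig_split// mulrDr. Qed.

Lemma fibre_averageZ (c : R) (f : X -> R) x : avg (fun y => c * f y) x = c * avg f x.
Proof. by rewrite /fibre_average -mulr_fsumr mulrCA. Qed.

Lemma fibre_average_cst (c : R) x : avg (fun=> c) x = c.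
Proof.
transitivity (avg (fun=> c * 1) x); first by rewrite mulr1.
rewrite (fibre_averageZ c (fun=> 1)) /fibre_average mulVf ?mulr1//.
exact/lt0r_neq0/Nfib_gt0.
Qed.

Lemma fibre_average_ge0 (f : X -> R) x : (forall y, 0 <= f y) -> 0 <= avg f x.
Proof. by move=> f0; rewrite mulr_ge0 ?fsumr_ge0// invr_ge0 ltW// Nfib_gt0. Qed.

Lemma fibre_average_eq0 (f : X -> R) x : (forall y, 0 <= f y) ->
  avg f x = 0 -> forall y, r y = x -> f y = 0.
Proof.
move=> f0 /eqP; rewrite mulf_eq0 invr_eq0 gt_eqF ?Nfib_gt0//=.
move=> /eqP fx y yx; move/(congr1 (fun z => z == 0)) : fx; rewrite eqxx => fx.
have := fx; rewrite (fsbigD1 y)//= paddr_eq0//; last exact: fsumr_ge0.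
by move=> /andP[/eqP].
Qed.

Section StronglyInvariant.
Variable mu : probability X R.
Hypothesis mu_si : strongly_invariant r mu.

(* [avg f] is not known to be measurable.  It is sandwiched between the lower
   envelope of [avg f] and one minus that of [avg (1 - f)], and strong invariance
   makes these two measurable functions have the same integral. *)
Let bounded_ae_measurable (f : X -> R) : measurable_fun setT f ->
  (forall x, 0 <= f x <= 1) ->
  exists g : X -> R, [/\ measurable_fun setT g, forall x, 0 <= g x,
    {ae mu, forall x, avg f x = g x} &
    (\int[mu]_x (g x)%:E = \int[mu]_x (f x)%:E)%E].
Proof.
move=> mf f01.
have f0 x : 0 <= f x by case/andP: (f01 x).
have f1 x : f x <= 1 by case/andP: (f01 x).
pose f' := fun x => 1 - f x.
have f'0 x : 0 <= f' x by rewrite subr_ge0.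
have mf' : measurable_fun setT f' by apply: measurable_funB.
have ff' x : avg f x + avg f' x = 1.
  rewrite -fibre_averageD -[RHS](fibre_average_cst 1 x).
  by apply: eq_fibre_average => y _; rewrite /f' addrC subrK.
have env (u : X -> R) : measurable_fun setT u -> (forall x, 0 <= u x) -> (forall x, u x <= 1) ->
    exists g : X -> \bar R, [/\ measurable_fun setT g, forall x, (0 <= g x)%E,
      forall x, (g x <= (avg u x)%:E)%E & (\int[mu]_x g x = \int[mu]_x (u x)%:E)%E].
  move=> mu' u0 u1.
  have uE : (\int[mu]_x (avg u x)%:E = \int[mu]_x (u x)%:E)%E.
    by apply/esym/mu_si => //; exists 1 => x; rewrite ger0_norm.
  have [||g [mg g0 gu gE]] := @lower_envelope _ _ _ mu (fun x => (avg u x)%:E).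
  - by move=> x; rewrite lee_fin fibre_average_ge0.
  - rewrite uE; apply: (@le_lt_trans _ _ (\int[mu]_x (cst 1 x))%E).
      apply: ge0_le_integral => //.
      - by move=> x _; rewrite lee_fin.
      - exact/measurable_EFinP.
      - by move=> x _; rewrite lee_fin.
    by rewrite integral_cst// mul1e -ge0_fin_numE//; exact: fin_num_measure.
  - by exists g; rewrite gE uE.
have [g [mg g0 gf gE]] := env f mf f0 f1.
have [g' [mg' g'0 g'f gE']] := env f' mf' f'0 (fun x => ltac:(by rewrite gerBl)).
have gg'1 : {ae mu, forall x, (g x + g' x = 1)%E}.
  apply: ae_eq_of_le_integral => //.
  - exact: emeasurable_funD.
  - by move=> x; rewrite adde_ge0.
  - by move=> x; rewrite -[leRHS]/(1%:E) -(ff' x) EFinD leeD.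
  - by rewrite integral_cst// mul1e -ge0_fin_numE//; exact: fin_num_measure.
  - rewrite ge0_integralD// gE gE' -ge0_integralD//.
    + by apply: eq_integral => x _; rewrite -EFinD /f' addrC subrK.
    + by move=> x _; rewrite lee_fin.
    + exact/measurable_EFinP.
    + by move=> x _; rewrite lee_fin.
    + exact/measurable_EFinP.
have gfin x : g x \is a fin_num by rewrite ge0_fin_numE// (le_lt_trans (gf x)) ?ltry.
have g'fin x : g' x \is a fin_num by rewrite ge0_fin_numE// (le_lt_trans (g'f x)) ?ltry.
exists (fun x => fine (g x)); split.
- exact: measurableT_comp.
- by move=> x; rewrite fine_ge0.
- apply: filterS gg'1 => x gg'.
  have := gf x; have := g'f x; rewrite -(fineK (gfin x)) -(fineK (g'fin x)) !lee_fin.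
  have : fine (g x) + fine (g' x) = 1.
    by apply: EFin_inj; rewrite EFinD !fineK.
  move: (ff' x); lra.
- by rewrite -gE; apply: eq_integral => x _; rewrite fineK.
Qed.

(** Strong invariance speaks of bounded functions only, so [f] is cut into the slices [s n] with
    values in [0, 1], and the versions of their averages are summed. On a finite fibre [f] is
    bounded, so the telescoping sum of averages is eventually constant and its value is the average
    of [f]. *)
Lemma fibre_average_ae_measurable (f : X -> R) : measurable_fun setT f ->
  (forall x, 0 <= f x) ->
  exists g : X -> R, [/\ measurable_fun setT g, forall x, 0 <= g x,
    {ae mu, forall x, avg f x = g x} &
    (\int[mu]_x (g x)%:E = \int[mu]_x (f x)%:E)%E].
Proof.
move=> mf f0.
pose t n x : R := Num.min (f x) n%:R.
pose s n x : R := t n.+1 x - t n x.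
have mt n : measurable_fun setT (t n) by exact: measurable_minr.
have ms n : measurable_fun setT (s n) by exact: measurable_funB.
have s01 n x : 0 <= s n x <= 1.
  rewrite /s /t -natr1; move: (f0 x) => fx0.
  have n0 : 0 <= n%:R :> R by [].
  by rewrite !minEle; case: ifPn; case: ifPn; rewrite -?ltNge; lra.
have s0 n x : 0 <= s n x by case/andP: (s01 n x).
have /choice[g gP] := fun n => bounded_ae_measurable (ms n) (s01 n).
pose G x := (\sum_(k <oo) (g k x)%:E)%E.
have g0 k x : (0 <= (g k x)%:E)%E by rewrite lee_fin; case: (gP k).
have mgE k : measurable_fun setT (fun x => (g k x)%:E).
  by apply/measurable_EFinP; case: (gP k).
have mG : measurable_fun setT G by apply: ge0_emeasurable_sum => // k x _ _.
have tE N x n : f x < N%:R -> (N <= n)%N -> t n x = f x.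
  move=> fN Nn; rewrite /t minEle ifT// (le_trans (ltW fN))// ler_nat//.
have t0 x : t 0%N x = 0 by rewrite /t minEle; case: ifPn => // fx; apply/eqP; rewrite eq_le fx f0.
have GE : {ae mu, forall x, (G x = (avg f x)%:E)%E}.
  have := ae_foralln (fun n => (let: And4 _ _ h _ := gP n in h)).
  apply: filterS => x gx.
  have [N fN] : exists N, forall y, r y = x -> f y < N%:R.
    exists (Num.truncn (\sum_(y \in fibre r x) f y)).+1 => y yx.
    apply: le_lt_trans (truncnS_gt _).
    by rewrite (fsbigD1 y)//= lerDl fsumr_ge0.
  rewrite /G -(@nneseries_telescope _ (fun n => avg (t n) x) _ N); last 2 first.
  - rewrite -[RHS](fibre_average_cst 0 x); exact: eq_fibre_average.
  - by move=> n Nn; apply: eq_fibre_average => y /fN fy; exact: tE Nn.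
  apply: eq_eseriesr => k _; rewrite -gx; congr (_%:E).
  apply/esym/eqP; rewrite subr_eq; apply/eqP.
  by rewrite -fibre_averageD; apply: eq_fibre_average => y _; rewrite /s subrK.
have GI : (\int[mu]_x G x = \int[mu]_x (f x)%:E)%E.
  rewrite integral_nneseries//.
  transitivity (\sum_(k <oo) \int[mu]_x (s k x)%:E)%E.
    by apply: eq_eseriesr => k _; case: (gP k).
  rewrite -integral_nneseries//; last 2 first.
  - by move=> k; exact/measurable_EFinP.
  - by move=> k x _; rewrite lee_fin.
  apply: eq_integral => x _.
  apply: (@nneseries_telescope _ (fun n => t n x) _ (Num.truncn (f x)).+1) => // n.
  by apply: tE; exact: truncnS_gt.
have G0 x : (0 <= G x)%E by exact: nneseries_ge0.
exists (fun x => fine (G x)); split.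
- exact: measurableT_comp.
- by move=> x; rewrite fine_ge0.
- by apply: filterS GE => x ->.
- rewrite -GI; apply: ge0_ae_eq_integral => //.
  + by apply/measurable_EFinP; exact: measurableT_comp.
  + by move=> x _; rewrite lee_fin fine_ge0.
  + by apply: filterS GE => x -> _.
Qed.

(** The average of the indicator of a null set has integral zero, so it vanishes almost everywhere,
    and a vanishing average of non-negative values forces each value to vanish. This carries
    almost-everywhere identities through a fibre average. *)
Lemma ae_fibre (P : X -> Prop) :
  {ae mu, forall y, P y} -> {ae mu, forall x, forall y, r y = x -> P y}.
Proof.
move=> [N [mN N0 PN]].
have N1 : (\int[mu]_x (\1_N x : R)%:E = 0)%E.
  by rewrite integral_indic// setIT; exact: N0.
have [||g [mg g0 gN gI]] := @fibre_average_ae_measurable (\1_N).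
- by [].
- by move=> x; rewrite indicE.
have g0' : {ae mu, forall x, (0 = (g x)%:E)%E}.
  apply: ae_eq_of_le_integral => //.
  - exact/measurable_EFinP.
  - by rewrite gI N1.
  - by rewrite gI N1 integral0.
apply: filterS2 gN g0' => x gx [gx0] y yx.
apply: contrapT => /PN Ny.
have : (\1_N y : R) = 0 by apply: (@fibre_average_eq0 \1_N x) => //; rewrite gx.
by rewrite indicE mem_set// => /eqP; rewrite oner_eq0.
Qed.

(** The indicator of the preimage of [A] is constant on each fibre, so its fibre average is the
    indicator of [A]. *)
Lemma strongly_invariant_invariant (A : set X) : measurable_fun setT r ->
  measurable A -> mu (r @^-1` A) = mu A.
Proof.
move=> mr mA.
have mrA : measurable (r @^-1` A) by rewrite -[X in measurable X]setTI; exact: mr.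
have muE (B : set X) : measurable B -> mu B = (\int[mu]_x (\1_B x : R)%:E)%E.
  by move=> mB; rewrite integral_indic// setIT.
rewrite !muE// (mu_si (f := \1_(r @^-1` A)))//; last first.
  by exists 1 => x; rewrite indicE ger0_norm// lern1 leq_b1.
apply: eq_integral => x _; congr (_%:E).
rewrite -[LHS]/(avg (\1_(r @^-1` A)) x) -[RHS](fibre_average_cst _ x).
by apply: eq_fibre_average => y <-.
Qed.

End StronglyInvariant.
End FibreAverage.

Lemma ge0_integral_comp d1 d2 (T1 : measurableType d1) (T2 : measurableType d2)
    (R : realType) (phi : T1 -> T2) (mu : {measure set T1 -> \bar R})
    (nu : {measure set T2 -> \bar R}) : measurable_fun setT phi ->
  (forall A, measurable A -> mu (phi @^-1` A) = nu A) ->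
  forall f : T2 -> \bar R, measurable_fun setT f -> (forall x, 0 <= f x)%E ->
  (\int[mu]_x f (phi x) = \int[nu]_x f x)%E.
Proof.
move=> mphi muE f mf f0.
pose mphi_mixin := isMeasurableFun.Build _ _ _ _ _ mphi.
pose phi' : {mfun _ >-> _} := HB.pack phi mphi_mixin.
transitivity (\int[pushforward mu phi']_x f x)%E.
  by rewrite ge0_integral_pushforward// preimage_setT.
by apply: eq_measure_integral => A mA _; exact: muE.
Qed.

(** * The maximal ergodic argument *)

Section Ergodic.
Context d (X : measurableType d) (R : realType) (r : X -> X) (mu : probability X R).
Hypothesis mr : measurable_fun setT r.
Hypothesis mu_inv : forall A, measurable A -> mu (r @^-1` A) = mu A.
Hypothesis mu_erg : ergodic r mu.

Section MaximalFunction.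
Variable f : X -> R.
Hypothesis f_int : mu.-integrable setT (EFin \o f).
Hypothesis f_neg : (\int[mu]_x (f x)%:E < 0)%E.

(** The maximum of the Birkhoff sums of [f] of length at most [n], the empty sum included. *)
Fixpoint maxsum (n : nat) (x : X) : R :=
  if n is n'.+1 then Num.max 0 (f x + maxsum n' (r x)) else 0.

Let mf : measurable_fun setT f.
Proof. exact/measurable_EFinP/measurable_int/f_int. Qed.

Lemma maxsum_ge0 n x : 0 <= maxsum n x.
Proof. by case: n => //= n; rewrite le_max lexx. Qed.

Lemma maxsum_nd n x : maxsum n x <= maxsum n.+1 x.
Proof.
elim: n x => [|n IH] x; first exact: maxsum_ge0.
change (Num.max 0 (f x + maxsum n (r x)) <= Num.max 0 (f x + maxsum n.+1 (r x))).
by rewrite ge_max !le_max lexx/= lerD2l IH orbT.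
Qed.

Lemma measurable_maxsum n : measurable_fun setT (maxsum n).
Proof.
elim: n => [|n IH] //=; apply: measurable_maxr => //.
by apply: measurable_funD => //; exact: measurableT_comp.
Qed.

Lemma integral_maxsum_comp n :
  (\int[mu]_x (maxsum n (r x))%:E = \int[mu]_x (maxsum n x)%:E)%E.
Proof.
apply: (@ge0_integral_comp _ _ _ _ _ r mu mu mr mu_inv (fun x => (maxsum n x)%:E)).
  by apply/measurable_EFinP; exact: measurable_maxsum.
by move=> x; rewrite lee_fin maxsum_ge0.
Qed.

Lemma maxsum_integrable n : mu.-integrable setT (EFin \o maxsum n) /\
  mu.-integrable setT (fun x => (maxsum n (r x))%:E).
Proof.
have comp k : mu.-integrable setT (EFin \o maxsum k) ->
    mu.-integrable setT (fun x => (maxsum k (r x))%:E).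
  move=> /integrableP[_ ki]; apply/integrableP; split.
    by apply/measurable_EFinP; apply: measurableT_comp => //; exact: measurable_maxsum.
  have -> : (\int[mu]_x `|(maxsum k (r x))%:E| = \int[mu]_x (maxsum k (r x))%:E)%E.
    by apply: eq_integral => x _; rewrite gee0_abs// lee_fin maxsum_ge0.
  rewrite integral_maxsum_comp; apply: le_lt_trans ki.
  rewrite le_eqVlt; apply/orP; left; apply/eqP.
  by apply: eq_integral => x _; rewrite gee0_abs// lee_fin maxsum_ge0.
suff mi : mu.-integrable setT (EFin \o maxsum n) by split => //; exact: comp.
elim: n => [|n IH]; first exact: integrable0.
apply: (@le_integrable _ _ _ _ _ measurableT _ (fun x => `|(f x)%:E| + (maxsum n (r x))%:E)%E).
- by apply/measurable_EFinP; exact: measurable_maxsum.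
- move=> x _ /=; rewrite lee_fin ger0_norm ?le_max ?lexx// ger0_norm ?addr_ge0 ?maxsum_ge0//.
  by rewrite ge_max addr_ge0 ?maxsum_ge0//= lerD2r ler_norm.
- by apply: integrableD => //; [exact: integrable_abse|exact: comp].
Qed.

(* The increments [maxsum n.+1 - maxsum n \o r = max (- maxsum n \o r, f)] have
   non-negative integral, and tend to [f] wherever [maxsum] is unbounded. *)
Lemma maxsum_bounded : {ae mu, forall x, exists C, forall n, maxsum n x <= C}.
Proof.
pose E := [set x | forall C : nat, exists n, C%:R < maxsum n x].
have nd x m n : (m <= n)%N -> maxsum m x <= maxsum n x.
  by apply: (@homo_leq _ (maxsum ^~ x) <=%R) => //; [exact: le_trans|move=> k; exact: maxsum_nd].
have mE : measurable E.
  rewrite (_ : E = \bigcap_C \bigcup_n (maxsum n @^-1` `]C%:R, +oo[%classic)); last first.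
    apply/seteqP; split => [x Ex C _|x Ex C].
      by have [n Cn] := Ex C; exists n => //=; rewrite in_itv/= Cn.
    by have [n _/=] := Ex C I; rewrite in_itv/= andbT; exists n.
  apply: bigcapT_measurable => C; apply: bigcupT_measurable => n.
  by rewrite -[X in measurable X]setTI; apply: measurable_maxsum.
(* Passing between [x] and [r x], the recursion changes the unbounded quantity by [f x] only; the
   margin [|f x|] in the threshold absorbs it. *)
have rE : r @^-1` E = E.
  apply/seteqP; split => x /= Ex C.
    have [n Cn] := Ex (Num.truncn (C%:R + `|f x|)).+1.
    exists n.+1 => /=; rewrite lt_max; apply/orP; right.
    have := lt_trans (truncnS_gt _) Cn; have := ler_norm (- f x); rewrite normrN; lra.
  have [[|n]] := Ex (Num.truncn (C%:R + `|f x|)).+1; first by rewrite /= ltNge ler0n.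
  move=> Cn; exists n; move: Cn => /=; rewrite lt_max ltNge ler0n/= => Cn.
  have := lt_trans (truncnS_gt _) Cn; have := ler_norm (f x); lra.
have [E0|E1] := mu_erg mE rE.
  exists E; split => // x /= Hx C; apply: contrapT => /forallNP HC; apply: Hx.
  by exists C%:R => n; rewrite leNgt; apply/negP; exact: HC.
exfalso; move: f_neg; apply/negP; rewrite -leNgt.
pose D n x := (maxsum n.+1 x - maxsum n (r x))%:E.
have D0 n : (0 <= \int[mu]_x D n x)%E.
  have [i1 _] := maxsum_integrable n.+1; have [i2 i3] := maxsum_integrable n.
  rewrite [X in (0 <= X)%E](_ : _ = \int[mu]_x (EFin \o maxsum n.+1) x -
      \int[mu]_x (maxsum n (r x))%:E)%E; last first.
    by rewrite -integralB.
  rewrite integral_maxsum_comp sube_ge0; last first.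
    by apply/orP; left; exact: integrable_fin_num.
  apply: ge0_le_integral => //.
  - by move=> x _; rewrite lee_fin maxsum_ge0.
  - by apply/measurable_EFinP; exact: measurable_maxsum.
  - by apply/measurable_EFinP; exact: measurable_maxsum.
  - by move=> x _; rewrite lee_fin maxsum_nd.
have DE n x : D n x = (Num.max (- maxsum n (r x)) (f x))%:E.
  by rewrite /D /= addr_maxl add0r addrK.
have aeE : {ae mu, forall x, E x}.
  exists (~` E); split; [exact: measurableC| |by []].
  by rewrite probability_setC// E1 subee.
have [|||||_ _ cvgD] := @dominated_convergence _ _ _ mu _ measurableT D
  (EFin \o f) (abse \o (EFin \o f)).
- move=> n; apply/measurable_EFinP; apply: measurable_funB; first exact: measurable_maxsum.
  by apply: measurableT_comp => //; exact: measurable_maxsum.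
- exact/measurable_EFinP.
- apply: filterS aeE => x; rewrite -rE => Ex _.
  apply: cvg_near_cst; have [N CN] := Ex (Num.truncn `|f x|).+1.
  exists N => //= n /= Nn; rewrite DE; congr (_%:E).
  rewrite maxEle ifT//.
  have := lt_trans (truncnS_gt _) (lt_le_trans CN (nd (r x) _ _ Nn)).
  have := ler_norm (- f x); rewrite normrN; lra.
- exact: integrable_abse.
(* [D n] equals [f], or else the non-positive number [- maxsum n (r x)], and the latter only where
   [f] lies below it; in both cases [|f|] dominates. *)
- apply: aeW => x n _; rewrite DE lee_fin.
  rewrite maxEle; case: ifPn => //; rewrite -ltNge => fx.
  have m0 := maxsum_ge0 n (r x); rewrite normrN (ger0_norm m0).
  by have := ler_norm (- f x); rewrite normrN; lra.
have <- := cvg_lim _ cvgD => //.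
by apply: lime_ge; [exact: cvgP cvgD|exact: nearW].
Qed.

Lemma birkhoff_sum_bounded :
  {ae mu, forall x, exists C, forall n, \sum_(0 <= k < n) f (iter k r x) <= C}.
Proof.
apply: filterS maxsum_bounded => x [C xC]; exists C => n; apply: le_trans (xC n).
elim: n x {xC} => [|n IH] x; first by rewrite big_nil.
rewrite big_nat_recl//= le_max lerD2l; apply/orP; right.
by under eq_bigr do rewrite -iterS iterSr; exact: IH.
Qed.

End MaximalFunction.

(** * Negative mean of ln h and summability of the cocycle *)

Section CocycleSum.
Variable h : X -> R.
Hypothesis mh : measurable_fun setT h.
Hypothesis h_ge0 : forall x, 0 <= h x.
Hypothesis h_gt0 : {ae mu, forall x, 0 < h x}.
Hypothesis h_int : (\int[mu]_x (h x)%:E = 1)%E.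
Hypothesis h_ne1 : ~ {ae mu, forall x, h x = 1}.
Hypothesis lnh_int : mu.-integrable setT (fun x => (ln (h x))%:E).

Lemma integral_ln_lt0 : (\int[mu]_x (ln (h x))%:E < 0)%E.
Proof.
rewrite ltNge; apply/negP => ln0.
pose u x := h x - 1 - ln (h x).
have mln : measurable_fun setT (fun x => ln (h x)).
  exact/measurable_EFinP/measurable_int/lnh_int.
have ih : mu.-integrable setT (EFin \o h).
  apply/integrableP; split; first exact/measurable_EFinP.
  by under eq_integral do rewrite gee0_abs ?lee_fin//; rewrite h_int ltry.
have i1 : mu.-integrable setT (EFin \o (fun=> 1 : R)) by exact: finite_measure_integrable_cst.
have one : (\int[mu]_x (1 : R)%:E = 1)%E.
  rewrite integral_cst//= mul1e; exact: probability_setT.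
have iu : mu.-integrable setT (EFin \o (fun x => h x - 1)).
  by have := integrableB measurableT ih i1.
have uE : (\int[mu]_x (u x)%:E = - \int[mu]_x (ln (h x))%:E)%E.
  transitivity (\int[mu]_x ((h x - 1)%:E - (ln (h x))%:E))%E; first exact: eq_integral.
  rewrite integralB_EFin//.
  rewrite [X in (X - _)%E](_ : _ = 0%E) ?add0e//.
  transitivity (\int[mu]_x ((h x)%:E - (1 : R)%:E))%E; first exact: eq_integral.
  by rewrite integralB_EFin// h_int one subee.
have mu_ : measurable_fun setT (EFin \o u).
  by apply/measurable_EFinP; apply: measurable_funB => //; exact: measurable_funB.
have key x : 0 < h x -> 0 <= u x.
  move=> hx; rewrite /u; have := expR_ge1Dx (ln (h x)); rewrite lnK ?posrE//; lra.
have u0 : (\int[mu]_x `|(u x)%:E| = 0)%E.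
  apply/eqP; rewrite eq_le integral_ge0 ?andbT//.
  suff -> : (\int[mu]_x `|(u x)%:E| = \int[mu]_x (u x)%:E)%E by rewrite uE oppe_le0.
  apply: ae_eq_integral => //; first exact: measurableT_comp.
  by apply: filterS h_gt0 => x hx _; rewrite gee0_abs// lee_fin key.
apply: h_ne1; have /(ae_eq_integral_abs mu measurableT mu_) u0' := u0.
apply: filterS2 h_gt0 u0' => x hx /(_ I)/= [ux].
have : ln (h x) == 0.
  apply/negPn/negP => /expR_gt1Dx; rewrite lnK ?posrE//; move: ux; rewrite /u; lra.
by move=> /eqP l0; rewrite -[LHS]lnK ?posrE// l0 expR0.
Qed.

Lemma cocycle_summable :
  {ae mu, forall x, (\sum_(n <oo) (\prod_(0 <= k < n) h (iter k r x))%:E < +oo)%E}.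
Proof.
have gfin : (\int[mu]_x (ln (h x))%:E)%E \is a fin_num by exact: integrable_fin_num lnh_int.
(* Half of the mean decay rate: [ln h + e] still has negative integral, and boundedness of its
   Birkhoff sums by [C] bounds those of [ln h] by [C - n e]. The products are thus dominated by a
   geometric sequence of ratio [expR (- e)]. *)
pose e := - fine (\int[mu]_x (ln (h x))%:E)%E / 2.
have e0 : 0 < e.
  rewrite divr_gt0// oppr_gt0 -lte_fin fineK//; exact: integral_ln_lt0.
have ie : mu.-integrable setT (EFin \o (fun=> e)) by exact: finite_measure_integrable_cst.
have fi : mu.-integrable setT (EFin \o (fun x => ln (h x) + e)).
  by have := integrableD measurableT lnh_int ie.
have fneg : (\int[mu]_x (ln (h x) + e)%:E < 0)%E.
  rewrite [ltLHS](_ : _ = \int[mu]_x ((EFin \o (fun x => ln (h x))) x + (EFin \o (fun=> e)) x))%E//.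
  rewrite integralD_EFin//= integral_cst//= [mu setT]probability_setT mule1.
  rewrite -(fineK gfin) -EFinD lte_fin; move: e0; rewrite /e; lra.
apply: filterS (birkhoff_sum_bounded fi fneg) => x [C xC].
pose q := expR (- e); have q1 : q < 1 by rewrite /q expR_lt1 oppr_lt0.
have q0 : 0 < q by exact: expR_gt0.
have wq n : \prod_(0 <= k < n) h (iter k r x) <= expR C * q ^+ n.
  apply: (@le_trans _ _ (expR (\sum_(0 <= k < n) ln (h (iter k r x))))).
    rewrite expR_sum; apply: ler_prod => k _; rewrite h_ge0/=.
    (* At a zero of [h] the logarithm is only a default value, but any exponential is an upper bound
       there. *)
    have [/eqP->|h0] := boolP (h (iter k r x) == 0); first exact: expR_ge0.
    by rewrite lnK// posrE lt0r h0 h_ge0.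
  rewrite /q -expRM_natl -expRD ler_expR.
  have := xC n; rewrite big_split/= sumr_const_nat subn0 -mulr_natl; lra.
apply: (@le_lt_trans _ _ (expR C * (1 - q)^-1)%:E); last exact: ltry.
apply: lime_le.
  by apply: is_cvg_nneseries => n _ _; rewrite lee_fin prodr_ge0.
apply: nearW => n; rewrite sumEFin lee_fin.
apply: le_trans (geometric_le_lim n (expR_ge0 C) q0 _); last by rewrite ger0_norm ?ltW.
by apply: ler_sum => k _; exact: wq.
Qed.

End CocycleSum.
End Ergodic.

(** * Squared moduli *)

Section Csq.
Variable R : realType.
Implicit Types z w : R[i].

Lemma csq_ge0 z : 0 <= csq z.
Proof. by rewrite addr_ge0 ?sqr_ge0. Qed.

Lemma csqM z w : csq (z * w) = csq z * csq w.
Proof. by case: z => a b; case: w => c d; rewrite /csq /=; ring. Qed.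

Lemma csq0 : csq (0 : R[i]) = 0.
Proof. by rewrite /csq /= expr0n addr0. Qed.

Lemma csq1 : csq (1 : R[i]) = 1.
Proof. by rewrite /csq /= expr1n expr0n addr0. Qed.

Lemma csq_eq0 z : csq z = 0 -> z = 0.
Proof.
case: z => a b; rewrite /csq /= => /eqP.
by rewrite paddr_eq0 ?sqr_ge0// !sqrf_eq0 => /andP[/eqP-> /eqP->].
Qed.

Lemma csqV z : csq z^-1 = (csq z)^-1.
Proof.
have [->|z0] := eqVneq z 0; first by rewrite invr0 csq0 invr0.
have cz0 : csq z != 0 by apply: contra_neq z0; exact: csq_eq0.
by apply: (mulfI cz0); rewrite -csqM divff// divff// csq1.
Qed.

Lemma csq_prod (I : Type) (s : seq I) (F : I -> R[i]) :
  csq (\prod_(i <- s) F i) = \prod_(i <- s) csq (F i).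
Proof. by apply: (big_morph (@csq R)); [exact: csqM|exact: csq1]. Qed.

Lemma cmeasurable_csq d (T : measurableType d) (D : set T) (f : T -> R[i]) :
  cmeasurable D f -> measurable_fun D (fun x => csq (f x)).
Proof. by move=> [mRe mIm]; apply: measurable_funD; exact: measurable_funX. Qed.

End Csq.

(** * Measures given by a density *)

Section DensityMeasure.
Local Open Scope ereal_scope.
Context d (T : measurableType d) (R : realType) (mu : {measure set T -> \bar R}).
Variable c : T -> \bar R.
Hypothesis mc : measurable_fun setT c.
Hypothesis c0 : forall x, 0 <= c x.

(** The two proofs are arguments so that the term itself carries what the measure structure attached
    to it requires. *)
Definition density_measure of measurable_fun setT c & (forall x, 0 <= c x) :=
  fun A : set T => \int[mu]_(x in A) c x.
Local Notation nu := (density_measure mc c0).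

Let nu0 : nu set0 = 0.
Proof. exact: integral_set0. Qed.

Let nu_ge0 A : 0 <= nu A.
Proof. exact: integral_ge0. Qed.

Let nu_sigma_additive : semi_sigma_additive nu.
Proof.
move=> /= A mA tA mUA; rewrite /density_measure ge0_integral_bigcup//.
  by apply: is_cvg_ereal_nneg_natsum_cond => n _ _; exact: nu_ge0.
exact: measurable_funTS.
Qed.

HB.instance Definition _ := isMeasure.Build _ _ _ nu nu0 nu_ge0 nu_sigma_additive.

End DensityMeasure.

Lemma integral_comp_density d1 d2 (T1 : measurableType d1) (T2 : measurableType d2)
    (R : realType) (phi : T1 -> T2) (mu1 : {measure set T1 -> \bar R})
    (mu2 : {measure set T2 -> \bar R}) (c : T2 -> R) :
  measurable_fun setT phi -> measurable_fun setT c -> (forall x, 0 <= c x) ->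
  (forall A, measurable A -> mu1 (phi @^-1` A) = \int[mu2]_(x in A) (c x)%:E)%E ->
  forall f : T2 -> \bar R, measurable_fun setT f -> (forall x, 0 <= f x)%E ->
  (\int[mu1]_x f (phi x) = \int[mu2]_x (f x * (c x)%:E))%E.
Proof.
move=> mphi mc c0 muE f mf f0.
pose mphi_mixin := isMeasurableFun.Build _ _ _ _ _ mphi.
pose phi' : {mfun _ >-> _} := HB.pack phi mphi_mixin.
transitivity (\int[pushforward mu1 phi']_x f x)%E.
  by rewrite ge0_integral_pushforward// preimage_setT.
by apply: integral_density => // A mA; exact: muE.
Qed.

(** * The solenoid *)

Section SequenceSpace.
Context d (X : measurableType d).
Variable r : X -> X.

Lemma measurable_coord n : measurable_fun setT (fun s : Seq X => s n).
Proof.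
move=> _ A mA; rewrite setTI; apply: sub_sigma_algebra.
by exists n, A.
Qed.

Lemma measurable_to_Seq d' (Y : measurableType d') (f : Y -> Seq X) :
  (forall n, measurable_fun setT (fun y => f y n)) -> measurable_fun setT f.
Proof.
move=> mf; apply: (@measurability _ _ Y (Seq X) setT f cylinder_gen erefl) => //.
move=> _ [_ [n [A [mA ->]]] <-].
exact: mf.
Qed.

Lemma measurable_shift : measurable_fun setT (@Defs.shift _ X).
Proof. by apply: measurable_to_Seq => n; exact: measurable_coord. Qed.

Hypothesis mr : measurable_fun setT r.

Lemma measurable_rinf : measurable_fun setT (rinf r).
Proof.
apply: measurable_to_Seq => -[|n]; last exact: measurable_coord.
by apply: measurableT_comp => //; exact: measurable_coord.
Qed.

Lemma measurable_iter d' (Y : measurableType d') (f : Y -> Y) n :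
  measurable_fun setT f -> measurable_fun setT (iter n f).
Proof. by move=> mf; elim: n => [|n IH]; [exact: measurable_id|exact: measurableT_comp mf IH]. Qed.

Lemma measurable_rinf_pow k : measurable_fun setT (rinf_pow r k).
Proof.
by case: k => n /=; apply: measurable_iter; [exact: measurable_rinf|exact: measurable_shift].
Qed.

Lemma measurable_rz k : measurable_fun setT (rz r k).
Proof. exact: measurableT_comp (measurable_coord 0) (measurable_rinf_pow k). Qed.

Lemma iter_rinf n k (z : Seq X) :
  iter n (rinf r) z k = if (k < n)%N then iter (n - k) r (z 0%N) else z (k - n)%N.
Proof.
elim: n k z => [|n IH] k z; first by rewrite subn0.
rewrite iterS; case: k => [|k] /=; last by rewrite IH ltnS subSS.
by rewrite IH subn0; case: n {IH}.
Qed.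

Lemma rz_nat n (z : Seq X) : rz r n%:Z z = iter n r (z 0%N).
Proof. by rewrite /rz /theta0 /= iter_rinf subn0; case: n. Qed.

Lemma iter_shift n k (z : Seq X) : iter n (@Defs.shift _ X) z k = z (n + k)%N.
Proof. by elim: n k => // n IH k; rewrite iterS [LHS]/Defs.shift IH addnS addSn. Qed.

Lemma rz_neg n (z : Seq X) : rz r (Negz n) z = z n.+1.
Proof. by rewrite /rz /theta0 [LHS](iter_shift n.+1 0) addn0. Qed.

Lemma shiftK z : Xinf r z -> rinf r (Defs.shift z) = z.
Proof. by move=> zX; apply/funext => -[|n] //=; exact: zX. Qed.

Lemma Xinf_rinf z : Xinf r z -> Xinf r (rinf r z).
Proof. by move=> zX [|n] //=; exact: zX. Qed.

Lemma Xinf_shift z : Xinf r z -> Xinf r (Defs.shift z).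
Proof. by move=> zX n; exact: zX. Qed.

Lemma Xinf_rinf_pow (k : int) z : Xinf r z -> Xinf r (rinf_pow r k z).
Proof.
move=> zX; case: k => n; rewrite /rinf_pow.
  by elim: n => //= n; exact: Xinf_rinf.
by elim: n.+1 => //= m; exact: Xinf_shift.
Qed.

Lemma rinf_pow1 (k : int) z : Xinf r z -> rinf_pow r (k + 1) z = rinf r (rinf_pow r k z).
Proof.
move=> zX; case: k => n; first by rewrite -PoszD addn1.
case: n => [|n].
  by rewrite /= shiftK.
have -> : (Negz n.+1 + 1 = Negz n)%R by lia.
by rewrite /= shiftK//; exact: (Xinf_rinf_pow (Negz n)).
Qed.

Lemma rinf_powN1 (k : int) z : Xinf r z -> rinf_pow r (k - 1) z = Defs.shift (rinf_pow r k z).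
Proof. by move=> zX; rewrite -{2}[k](subrK 1) rinf_pow1. Qed.

(** On arbitrary sequences [shift] is only a left inverse of [rinf]. On [Xinf], which both maps
    preserve, it is a two-sided inverse, and the powers form an action of the integers. *)
Lemma rinf_powD (k l : int) z : Xinf r z ->
  rinf_pow r (k + l) z = rinf_pow r k (rinf_pow r l z).
Proof.
move=> zX; have lX := Xinf_rinf_pow l zX.
case: k => n; elim: n => [|n IH]; first by rewrite add0r.
- by rewrite -addn1 PoszD addrAC rinf_pow1// IH -rinf_pow1.
- by rewrite (_ : Negz 0 + l = l - 1)%R ?rinf_powN1//; lia.
- rewrite (_ : Negz n.+1 + l = (Negz n + l) - 1)%R; last by lia.
  by rewrite rinf_powN1// IH.
Qed.

End SequenceSpace.

Lemma ae_int d (T : measurableType d) (R : realType) (mu : {measure set T -> \bar R})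
    (P : int -> T -> Prop) :
  (forall k : int, {ae mu, forall x, P k x}) -> {ae mu, forall x, forall k : int, P k x}.
Proof.
move=> HP; have H1 := ae_foralln (fun n => HP (Posz n)).
have H2 := ae_foralln (fun n => HP (Negz n)).
by apply: filterS2 H1 H2 => x x1 x2 [n|n].
Qed.

(** * Change of variables on the solenoid *)

Section SolenoidMeasure.
Context d (X : measurableType d) (R : realType) (r : X -> X) (mu : probability X R).
Variables (m0 : X -> R[i]) (mu_inf : {measure set (Seq X) -> \bar R}).
Hypothesis mr : measurable_fun setT r.
Hypothesis r_finite : forall x, finite_set (fibre r x).
Hypothesis r_onto : forall x, exists y, r y = x.
Hypothesis mu_si : strongly_invariant r mu.
Hypothesis mm0 : cmeasurable setT m0.
Hypothesis m0_neq0 : {ae mu, forall x, m0 x <> 0}.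
Hypothesis mu_infP : is_solenoid_measure r m0 mu mu_inf.
Local Notation h := (fun x => csq (m0 x)).

Let mh : measurable_fun setT h.
Proof. exact: cmeasurable_csq. Qed.

Let mh0 : measurable_fun setT (fun z : Seq X => h (z 0%N)).
Proof. exact: measurableT_comp mh (measurable_coord 0). Qed.

(** On the fibre over [x] the denominator of [W y] is the constant [Nfib r x], so one step of the
    path sum is a fibre average weighted by h. Strong invariance thereby becomes applicable to path
    weights. *)
Lemma cwS n (A : nat -> set X) x :
  cw r m0 n.+1 A x =
  fibre_average r (fun y => h y * (\1_(A 1%N) y * cw r m0 n (fun k => A k.+1) y)) x.
Proof.
rewrite /= /fibre_average mulr_fsumr; apply: eq_fsbigr => y; rewrite inE => yx.
by rewrite /W (yx : r y = x) (mulrC (csq (m0 y))) -!mulrA.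
Qed.

(** Each step averages the previous weight, which is known only up to a null set; [ae_fibre] ensures
    that at almost every point the whole fibre avoids that null set. *)
Lemma cw_ae_measurable n (A : nat -> set X) : (forall k, measurable (A k)) ->
  exists c : X -> R, [/\ measurable_fun setT c, forall x, 0 <= c x &
    {ae mu, forall x, cw r m0 n A x = c x}].
Proof.
elim: n A => [|n IH] A mA.
  by exists (fun=> 1); split => //; exact: aeW.
have [c [mc c0 cE]] := IH (fun k => A k.+1) (fun k => mA k.+1).
have [||g [mg g0 gE _]] := @fibre_average_ae_measurable _ _ _ _ r_finite r_onto _ mu_si
    (fun y => h y * (\1_(A 1%N) y * c y)).
- apply: measurable_funM => //; apply: measurable_funM => //.
- by move=> x; rewrite !mulr_ge0// csq_ge0.
exists g; split => //.
apply: filterS2 gE (ae_fibre r_finite r_onto mu_si cE) => x <- cx.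
by rewrite cwS; apply: eq_fibre_average => y /cx ->.
Qed.

Lemma cw_ge0 n (A : nat -> set X) x : 0 <= cw r m0 n A x.
Proof.
elim: n A x => [|n IH] A x; first exact: ler01.
rewrite cwS fibre_average_ge0// => y.
by rewrite !mulr_ge0// ?csq_ge0// indicE.
Qed.

Lemma eq_cw n (A B : nat -> set X) x : (forall k, A k.+1 = B k.+1) ->
  cw r m0 n A x = cw r m0 n B x.
Proof.
move=> AB; case: n => // n; rewrite !cwS AB.
by rewrite (_ : (fun k => A k.+1) = (fun k => B k.+1))//; apply/funext.
Qed.

Lemma integral_cw (n : nat) (A : nat -> set X) (B : set X) (c : X -> R) :
  measurable B -> measurable_fun setT c -> (forall x, 0 <= c x) ->
  {ae mu, forall x, cw r m0 n A x = c x} ->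
  (\int[mu]_x (\1_B x * cw r m0 n A x)%:E = \int[mu]_(x in B) (c x)%:E)%E.
Proof.
move=> mB mc c0 cE; rewrite [RHS]integral_mkcond epatch_indic.
apply: ae_eq_lower_integral.
- by apply: emeasurable_funM; exact/measurable_EFinP.
- by move=> x; rewrite lee_fin mulr_ge0// ?indicE// cw_ge0.
- by move=> x; rewrite mule_ge0// ?lee_fin// indicE.
- by apply: filterS cE => x -> /=; rewrite -EFinM mulrC.
Qed.

Lemma measurable_cylinder (n : nat) (A : nat -> set X) : (forall k, measurable (A k)) ->
  measurable [set s : Seq X | forall k, (k <= n)%N -> A k (s k)].
Proof.
move=> mA.
rewrite (_ : [set s | _] =
    \bigcap_k (if (k <= n)%N then (fun s : Seq X => s k) @^-1` A k else setT)).
  apply: bigcapT_measurable => k; case: ifP => // _.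
  by rewrite -[X in measurable X]setTI; exact: measurable_coord.
apply/seteqP; split => [s As k _|s As k kn]; first by case: ifPn => // /As.
by have := As k I; rewrite kn.
Qed.

Lemma mu_inf_theta0 (A : set X) : measurable A -> mu_inf (@theta0 _ X @^-1` A) = mu A.
Proof.
move=> mA; have := mu_infP.2 0%N (fun=> A) (fun=> mA).
rewrite (_ : [set s | _] = @theta0 _ X @^-1` A); last first.
  by apply/seteqP; split => [s /(_ 0%N (leqnn _))//|s As [|]].
move=> ->; rewrite -integral_indicT//.
by apply: eq_integral => x _; rewrite mulr1.
Qed.

Lemma mu_inf_fin (A : set (Seq X)) : measurable A -> (mu_inf A < +oo)%E.
Proof.
move=> mA; apply: (@le_lt_trans _ _ (mu_inf setT)).
  exact: le_measure (mem_set _) (mem_set _) _.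
rewrite -(preimage_setT (@theta0 _ X)) mu_inf_theta0//.
by rewrite -ge0_fin_numE//; exact: fin_num_measure.
Qed.

(** Both sides are finite measures in [B], so it suffices to compare them on cylinders, a pi-system.
    There the left side integrates one more fibre average than the right, and strong invariance
    removes it, leaving the factor h. *)
Lemma mu_inf_shift (B : set (Seq X)) : measurable B ->
  mu_inf (Defs.shift @^-1` B) = (\int[mu_inf]_(z in B) (h (z 0%N))%:E)%E.
Proof.
have h0E (z : Seq X) : (0 <= (h (z 0%N))%:E)%E by rewrite lee_fin csq_ge0.
have mh0E : measurable_fun setT (fun z : Seq X => (h (z 0%N))%:E) by exact/measurable_EFinP.
pose m2 := density_measure mu_inf mh0E h0E.
pose sm := isMeasurableFun.Build _ _ _ _ _ (@measurable_shift _ X).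
pose sh : {mfun _ >-> _} := HB.pack (@Defs.shift _ X) sm.
pose cyl n (A : nat -> set X) : set (Seq X) := [set s : Seq X | forall k, (k <= n)%N -> A k (s k)].
pose G := [set C | exists n (A : nat -> set X), (forall k, measurable (A k)) /\ C = cyl n A].
move=> mB.
apply: (@measure_unique _ _ _ G (fun=> setT) _ _ _ _ (pushforward mu_inf sh) m2) => //.
- apply/seteqP; split; apply: smallest_sub => //; try exact: smallest_sigma_algebra.
    move=> _ [n [A [mA ->]]]; apply: sub_sigma_algebra.
    exists n, (fun k => if k == n then A else setT); split.
      by move=> k; case: ifP.
    apply/seteqP; split => [s As k _|s /(_ n (leqnn _))]; last by rewrite eqxx.
    by case: eqP => // ->.
  move=> _ [n [A [mA ->]]]; exact: measurable_cylinder.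
- move=> _ _ [n [A [mA ->]]] [m [B' [mB' ->]]].
  exists (maxn n m), (fun k =>
    (if (k <= n)%N then A k else setT) `&` (if (k <= m)%N then B' k else setT)); split.
    by move=> k; apply: measurableI; case: ifP.
  apply/seteqP; split => [s [As Bs] k _|s Ss].
    by split; case: ifPn => // /[dup]; [move=> _ /As|move=> _ /Bs].
  split => k kn; have := Ss k; rewrite leq_max kn ?orbT => /(_ isT)[] //.
- by move=> _; exists 0%N, (fun=> setT); split => //; apply/seteqP; split.
- by rewrite bigcup_const.
- move=> _ [n [A [mA ->]]].
  have [c [mc c0 cE]] := cw_ae_measurable n mA.
  (* The preimage of a cylinder under [shift]: every constraint moves up one coordinate and the
     zeroth becomes free. *)
  pose A' k := if k is k'.+1 then A k' else setT.
  have mA' k : measurable (A' k) by case: k => //=.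
  transitivity (mu_inf (cyl n.+1 A')).
    congr (mu_inf _); apply/seteqP; split => [s As [|k]//= kn|s As k kn]; first exact: As.
    exact: (As k.+1).
  rewrite mu_infP.2//.
  have [||g [mg g0 gE gI]] := @fibre_average_ae_measurable _ _ _ _ r_finite r_onto _ mu_si
    (fun y => h y * (\1_(A 0%N) y * c y)).
  + by apply: measurable_funM => //; apply: measurable_funM.
  + by move=> x; rewrite !mulr_ge0// csq_ge0.
  rewrite (@integral_cw n.+1 A' setT g)//; last first.
    apply: filterS2 gE (ae_fibre r_finite r_onto mu_si cE) => x <- cx.
    by rewrite cwS; apply: eq_fibre_average => y /cx <-.
  rewrite gI.
  (* Only the constraints on coordinates 1 to [n] are kept. Restricted to [C'], the solenoid measure
     projects under [theta0] to the measure of density [c] with respect to [mu], which reduces the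
     integral to one over X. *)
  pose C' : set (Seq X) := cyl n (fun k => if k is k'.+1 then A k else setT).
  have mC' : measurable C' by apply: measurable_cylinder => -[|k].
  have m2E : density_measure mu_inf mh0E h0E (cyl n A) =
      (\int[mu_inf]_z ((\1_(A 0%N) (theta0 z) * h (theta0 z))%:E * (\1_C' z)%:E))%E.
    rewrite /density_measure/= integral_mkcond epatch_indic.
    apply: eq_integral => z _ /=; rewrite -!EFinM; congr (_%:E).
    suff -> : \1_(cyl n A) z = \1_(A 0%N) (theta0 z) * \1_C' z :> R by rewrite mulrCA mulrA.
    rewrite !indicE -natrM mulnb; congr (nat_of_bool _)%:R; apply/idP/andP; rewrite !inE.
      by move=> Az; split => [|[|k] kn//]; [exact: (Az 0%N)|exact: (Az k.+1)].
    by move=> [Az Cz] [|k] kn//; exact: (Cz k.+1).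
  apply: etrans (esym m2E).
  rewrite -(@integral_density _ _ _ mu_inf (mrestr mu_inf mC') (\1_C')) //.
  + rewrite (@integral_comp_density _ _ _ _ _ (@theta0 _ X) (mrestr mu_inf mC') mu c
      _ _ _ _ (fun x => (\1_(A 0%N) x * h x)%:E))//.
    * by apply: eq_integral => x _; rewrite -EFinM; congr (_%:E); rewrite mulrA (mulrC (csq _)).
    * exact: measurable_coord.
    * move=> D mD; rewrite -(@integral_cw n A D c)//.
      have mD' : forall k, measurable ((fun k => if k is k'.+1 then A k else D) k).
        by case.
      transitivity (mu_inf (cyl n (fun k => if k is k'.+1 then A k else D))).
        congr (mu_inf _); apply/seteqP; split => [s [/= Ds Cs] [|k] kn//|s Ss].
          exact: (Cs k.+1).
        by split=> [|[|k] kn//]; [exact: (Ss 0%N)|exact: (Ss k.+1)].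
      rewrite (mu_infP.2 _ _ mD'); apply: eq_integral => x _; congr (_ * _)%:E.
      exact: eq_cw.
    * by apply/measurable_EFinP; apply: measurable_funM.
    * by move=> x; rewrite lee_fin mulr_ge0// csq_ge0.
  + by move=> D mD; rewrite integral_indic// setIC.
  + apply/measurable_EFinP; apply: measurable_funM => //.
    by apply: measurableT_comp => //; exact: measurable_coord.
  + by move=> z; rewrite lee_fin mulr_ge0// csq_ge0.
- by move=> _; change (mu_inf setT < +oo)%E; exact: mu_inf_fin.
Qed.

Lemma integral_shift (f : Seq X -> \bar R) :
  measurable_fun setT f -> (forall z, 0 <= f z)%E ->
  (\int[mu_inf]_z f (Defs.shift z) = \int[mu_inf]_z (f z * (h (z 0%N))%:E))%E.
Proof.
apply: (@integral_comp_density _ _ _ _ _ (@Defs.shift _ X) mu_inf mu_inf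
  (fun z => h (z 0%N))) => //.
- exact: measurable_shift.
- by move=> z; exact: csq_ge0.
- exact: mu_inf_shift.
Qed.

Lemma ae_Xinf : {ae mu_inf, forall z, Xinf r z}.
Proof. exact: mu_infP.1. Qed.

Lemma integral_rinf (f : Seq X -> \bar R) :
  measurable_fun setT f -> (forall z, 0 <= f z)%E ->
  (\int[mu_inf]_z (f (rinf r z) * (h (z 0%N))%:E) = \int[mu_inf]_z f z)%E.
Proof.
move=> mf f0; have mrf := measurable_rinf mr.
have mfr : measurable_fun setT (fun z => f (rinf r z)) by exact: measurableT_comp.
rewrite -(integral_shift mfr)//.
apply: ae_eq_integral => //.
- by apply: (measurableT_comp mfr); exact: measurable_shift.
- by apply: (aeS ae_Xinf) => z zX _; rewrite shiftK.
Qed.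

Lemma ae_theta0 (P : X -> Prop) : {ae mu, forall x, P x} ->
  {ae mu_inf, forall z, P (z 0%N)}.
Proof.
move=> [N [mN N0 PN]]; exists (@theta0 _ X @^-1` N); split.
- by rewrite -[X in measurable X]setTI; exact: measurable_coord.
- by rewrite mu_inf_theta0.
- by move=> z /= Pz; apply: PN.
Qed.

Lemma ae_shift (P : Seq X -> Prop) : {ae mu_inf, forall z, P z} ->
  {ae mu_inf, forall z, P (Defs.shift z)}.
Proof.
move=> [N [mN N0 PN]]; exists (Defs.shift @^-1` N); split.
- by rewrite -[X in measurable X]setTI; exact: measurable_shift.
- rewrite mu_inf_shift// integral_mkcond -(integral0 mu_inf setT).
  apply: ae_eq_integral => //.
    by apply/(measurable_restrictT _ _).1 => //; exact/measurable_EFinP/measurable_funTS.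
  exists N; split => // z /= /not_implyP[_]; rewrite patchE; case: ifPn => //.
  by rewrite inE.
- by move=> z /= Pz; apply: PN.
Qed.

Lemma ae_h_neq0 : {ae mu_inf, forall z : Seq X, h (z 0%N) != 0}.
Proof.
by apply: (aeS (ae_theta0 m0_neq0)) => z; apply: contra_notN => /eqP/csq_eq0.
Qed.

(** For a null set N, the integral of 1_N(r_infty z) h(z_0) equals the measure of N, hence vanishes.
    Since h is non-zero almost everywhere, the indicator itself must vanish. *)
Lemma ae_rinf (P : Seq X -> Prop) : {ae mu_inf, forall z, P z} ->
  {ae mu_inf, forall z, P (rinf r z)}.
Proof.
move=> [N [mN N0 PN]].
have mN' : measurable (rinf r @^-1` N).
  by rewrite -[X in measurable X]setTI; apply: (measurable_rinf mr).
have : (\int[mu_inf]_z `|(\1_N (rinf r z))%:E * (h (z 0%N))%:E| = 0)%E.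
  under eq_integral do rewrite gee0_abs ?mule_ge0 ?lee_fin ?csq_ge0 ?indicE//.
  rewrite (@integral_rinf (fun z => (\1_N z)%:E))//.
    by rewrite integral_indic// setIT.
  exact/measurable_EFinP.
move=> /(ae_eq_integral_abs _ measurableT _).1; move=> /(_ _)/wrap[].
  apply: emeasurable_funM; apply/measurable_EFinP => //.
  exact: measurable_indic mN'.
move=> Nh; apply: (aeS2 ae_h_neq0 Nh) => z hz /(_ I) /=.
rewrite -EFinM => -[] /eqP; rewrite mulf_eq0 (negbTE hz) orbF => /eqP Nz.
apply: contrapT => /PN zN; move: Nz; rewrite indicE mem_set//.
by move=> /eqP; rewrite oner_eq0.
Qed.

Lemma ae_rinf_pow (P : Seq X -> Prop) : {ae mu_inf, forall z, P z} ->
  {ae mu_inf, forall z, forall k : int, P (rinf_pow r k z)}.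
Proof.
move=> aeP; apply: ae_int => -[] n; rewrite /rinf_pow.
  elim: n => //= n IH.
  by apply: (aeS (ae_rinf IH)) => z; rewrite -iterSr.
elim: n.+1 => // m IH.
by apply: (aeS (ae_shift IH)) => z; rewrite -iterSr.
Qed.

Lemma ae_rz_neq0 : {ae mu_inf, forall z, forall k : int, m0 (rz r k z) <> 0}.
Proof. exact: ae_rinf_pow (ae_theta0 m0_neq0). Qed.

Lemma mtilde_nat (n : nat) (z : Seq X) :
  mtilde r m0 n%:Z z = \prod_(0 <= j < n) m0 (iter j r (z 0%N)).
Proof. by rewrite /mtilde; apply: eq_bigr => j _; rewrite rz_nat. Qed.

Let measurable_inv d' (T : measurableType d') (f : T -> R) :
  measurable_fun setT f -> (forall x, 0 <= f x) -> measurable_fun setT (fun x => (f x)^-1).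
Proof.
move=> mf f0; apply: (eq_measurable_fun (fun x => f x `^ (-1))).
  by move=> x _; rewrite powR_inv1.
exact: measurableT_comp (measurable_powR _) mf.
Qed.

Let measurable_prodh (I : seq nat) : measurable_fun setT (fun z : Seq X => \prod_(j <- I) h (z j)).
Proof.
by apply: measurable_prod => j _; apply: measurableT_comp mh _; exact: measurable_coord.
Qed.

Let prodh_ge0 (I : seq nat) (z : Seq X) : 0 <= \prod_(j <- I) h (z j).
Proof. by apply: prodr_ge0 => j _; exact: csq_ge0. Qed.

Lemma csq_mtilde_nat (n : nat) (z : Seq X) :
  csq (mtilde r m0 n%:Z z) = \prod_(0 <= j < n) h (iter j r (z 0%N)).
Proof. by rewrite mtilde_nat csq_prod. Qed.

Lemma csq_mtilde_neg (n : nat) (z : Seq X) :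
  csq (mtilde r m0 (Negz n) z) = (\prod_(1 <= j < n.+2) h (z j))^-1.
Proof. by rewrite /mtilde csqV csq_prod. Qed.

Lemma measurable_csq_mtilde k : measurable_fun setT (fun z => csq (mtilde r m0 k z)).
Proof.
case: k => n.
  apply: (eq_measurable_fun (fun z : Seq X => \prod_(0 <= j < n) h (iter j r (z 0%N)))).
    by move=> z _; rewrite csq_mtilde_nat.
  apply: measurable_prod => j _; apply: measurableT_comp mh _.
  by apply: measurableT_comp (measurable_iter j mr) _; exact: measurable_coord.
apply: (eq_measurable_fun (fun z : Seq X => (\prod_(1 <= j < n.+2) h (z j))^-1)).
  by move=> z _; rewrite csq_mtilde_neg.
apply: measurable_inv; first exact: measurable_prodh.
by move=> z; exact: prodh_ge0.
Qed.

Let integral_iter_shift k (f : Seq X -> \bar R) :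
  measurable_fun setT f -> (forall z, 0 <= f z)%E ->
  (\int[mu_inf]_z (f (iter k (@Defs.shift _ X) z) * ((\prod_(1 <= j < k.+1) h (z j))^-1)%:E) =
   \int[mu_inf]_z f z)%E.
Proof.
move=> mf f0; elim: k => [|k IH].
  by apply: eq_integral => z _; rewrite big_geq// invr1 mule1.
have minv (I : seq nat) : measurable_fun setT (fun z : Seq X => ((\prod_(j <- I) h (z j))^-1)%:E).
  apply/measurable_EFinP; apply: measurable_inv; first exact: measurable_prodh.
  by move=> z; exact: prodh_ge0.
have mfk : measurable_fun setT (fun z => f (iter k (@Defs.shift _ X) z)).
  by apply: measurableT_comp mf _; apply: measurable_iter; exact: measurable_shift.
(* The product starts at index 0: composing with [shift] turns it into the product from 1 to [k.+1],
   while the density h(z_0) produced by [integral_shift] cancels the extra factor. *)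
pose psi z := (f (iter k (@Defs.shift _ X) z) * ((\prod_(0 <= j < k.+1) h (z j))^-1)%:E)%E.
have mpsi : measurable_fun setT psi by apply: emeasurable_funM.
have psi0 z : (0 <= psi z)%E by rewrite mule_ge0// lee_fin invr_ge0.
rewrite -IH; transitivity (\int[mu_inf]_z psi (Defs.shift z))%E.
  by apply: eq_integral => z _; rewrite iterSr /psi big_add1.
rewrite integral_shift//; apply: ae_eq_integral => //.
- by apply: emeasurable_funM => //; exact/measurable_EFinP.
- exact: emeasurable_funM.
- apply: (aeS ae_h_neq0) => z hz _; rewrite /psi -muleA -EFinM; congr (_ * _%:E)%E.
  by rewrite big_ltn// invfM mulrAC mulVf// mul1r.
Qed.

Lemma integral_rinf_pow k (f : Seq X -> \bar R) :
  measurable_fun setT f -> (forall z, 0 <= f z)%E ->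
  (\int[mu_inf]_z (f (rinf_pow r k z) * (csq (mtilde r m0 k z))%:E) = \int[mu_inf]_z f z)%E.
Proof.
case: k => n; last first.
  move=> mf f0; rewrite -(integral_iter_shift n.+1 mf f0).
  by apply: eq_integral => z _; rewrite csq_mtilde_neg.
elim: n f => [|n IH] f mf f0.
  by apply: eq_integral => z _; rewrite csq_mtilde_nat big_geq// mule1.
(* Evaluated at the [n]-th image of [z], the factor h of [F] is h(r^n z_0), the last factor of the
   next density. *)
pose F z := (f (rinf r z) * (h (z 0%N))%:E)%E.
rewrite -(integral_rinf mf f0) -(IH F).
- apply: eq_integral => z _; rewrite /F !csq_mtilde_nat big_nat_recr//=.
  rewrite iter_rinf subn0 [in RHS]muleAC -muleA -EFinM; congr (_ * _%:E)%E.
  by case: (n).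
- apply: emeasurable_funM; last exact/measurable_EFinP.
  by apply: measurableT_comp mf _; exact: measurable_rinf.
- by move=> z; rewrite mule_ge0// lee_fin csq_ge0.
Qed.

End SolenoidMeasure.

(** * The fundamental domain *)

Section FirstVisit.
Context d (X : measurableType d) (r : X -> X).
Hypothesis mr : measurable_fun setT r.
Hypothesis mXinf : measurable (Xinf r).
Variable A : nat -> set X.
Hypothesis mA : forall M, measurable (A M).

(* [M] is the least index such that the orbit of [z] meets [A M], and [z] is the
   first point of its orbit that lies over [A M]. *)
Definition first_visit : set (Seq X) :=
  [set z | Xinf r z /\ exists M, [/\ A M (z 0%N), forall n, ~ A M (z n.+1) &
    forall (k : int) M', (M' < M)%N -> ~ A M' (rz r k z)]].

Lemma measurable_first_visit : measurable first_visit.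
Proof.
have mpre d1 (T : measurableType d1) (f : T -> X) B : measurable_fun setT f -> measurable B ->
    measurable (f @^-1` B).
  by move=> mf mB; rewrite -[X in measurable X]setTI; exact: mf.
pose P M (k : int) M' : set (Seq X) := if (M' < M)%N then rz r k @^-1` (~` A M') else setT.
have mP M k M' : measurable (P M k M').
  rewrite /P; case: ifP => // _; apply: mpre; [exact: measurable_rz|exact: measurableC].
rewrite (_ : first_visit = Xinf r `&` \bigcup_M (((fun s : Seq X => s 0%N) @^-1` A M `&`
    \bigcap_n ((fun s : Seq X => s n.+1) @^-1` (~` A M))) `&`
    (\bigcap_n \bigcap_M' P M (Posz n) M' `&` \bigcap_n \bigcap_M' P M (Negz n) M'))).
  apply: measurableI => //; apply: bigcupT_measurable => M; apply: measurableI; apply: measurableI.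
  - by apply: mpre => //; exact: measurable_coord.
  - apply: bigcapT_measurable => n.
    by apply: mpre; [exact: measurable_coord|exact: measurableC].
  - by apply: bigcapT_measurable => n; exact: bigcapT_measurable.
  - by apply: bigcapT_measurable => n; exact: bigcapT_measurable.
apply/seteqP; split => z [zX [M]].
  move=> [Mz Mn Mk]; split => //; exists M => //; split.
    by split => // n _; exact: Mn.
  by split=> n _ M' _; rewrite /P; case: ifP => // /Mk; exact.
move=> _ [[Mz Mn] [M1 M2]]; split => //; exists M; split => //.
  by move=> n; exact: Mn.
move=> [n|n] M' MM'.
  by have := M1 n I M' I; rewrite /P MM'.
by have := M2 n I M' I; rewrite /P MM'.
Qed.

Lemma rz_rinf_pow (k l : int) z : Xinf r z -> rz r k (rinf_pow r l z) = rz r (k + l) z.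
Proof. by move=> zX; rewrite /rz rinf_powD. Qed.

Lemma rz_opp (n : nat) (z : Seq X) : rz r (- n%:Z) z = z n.
Proof. by case: n => [|n] //; rewrite -NegzE rz_neg. Qed.

(** The least index [M] depends on the orbit only, so it is common to both points. Whichever of the
    two lies further back appears among the later coordinates of the other, which avoid [A M]; this
    contradicts its own visit. *)
Lemma first_visit_unique (k : int) z :
  first_visit z -> first_visit (rinf_pow r k z) -> k = 0.
Proof.
move=> [zX [M [Mz Mn Mk]]] [_ [M' [Mz' Mn' Mk']]].
have rz0 (y : Seq X) : rz r 0 y = y 0%N by [].
have MM' : M = M'.
  have [ltM|ltM|//] := ltngtP M M'; exfalso.
    by apply: (Mk' (- k) M ltM); rewrite rz_rinf_pow// addNr rz0.
  by apply: (Mk k M' ltM); rewrite -[k]add0r -rz_rinf_pow.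
subst M'; case: k Mz' Mn' Mk' => -[|n]//.
- move=> _ /(_ n) + _; have := @rz_rinf_pow (- n.+1%:Z) n.+1 z zX.
  by rewrite addNr rz_opp => ->.
- by move=> + _ _; rewrite -[_ 0%N]/(rz r (Negz 0) z) rz_neg => /Mn.
- by move=> + _ _; rewrite -[_ 0%N]/(rz r (Negz n.+1) z) rz_neg => /Mn.
Qed.

(** Take the least [M] whose level the orbit meets. Since the coordinates of [z] eventually avoid
    [A M], the visiting times are bounded below, so one of them is the earliest. *)
Lemma first_visit_exists z : Xinf r z -> (exists M, A M (z 0%N)) ->
  (forall M, exists N, forall n, (N <= n)%N -> ~ A M (z n)) ->
  exists k : int, first_visit (rinf_pow r k z).
Proof.
move=> zX [M0 M0z] far.
have exM : exists M, `[< exists k : int, A M (rz r k z) >].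
  by exists M0; apply/asboolP; exists 0.
case: (ex_minnP exM) => M /asboolP[k0 k0M] minM.
have [N farN] := far M.
have low (k : int) : A M (rz r k z) -> - N%:Z < k.
  move=> Mk; rewrite ltNge; apply/negP => kN.
  have [n kE] : exists n : nat, k = - n%:Z by exists (absz k); lia.
  by move: Mk kN; rewrite kE rz_opp => Mk kN; apply: (farN n) => //; lia.
(* Times are offset by the lower bound [- N], so that the earliest visit is a minimum over natural
   numbers. *)
have exj : exists j : nat, `[< A M (rz r (j%:Z - N%:Z) z) >].
  exists (absz (k0 + N%:Z)); apply/asboolP.
  by rewrite (_ : _ - _ = k0)//; have := low _ k0M; lia.
case: (ex_minnP exj) => j /asboolP jM minj.
exists (j%:Z - N%:Z); split; first exact: Xinf_rinf_pow.
exists M; split.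
- exact: jM.
- move=> n; rewrite -rz_opp rz_rinf_pow// => Mn.
  have [nj|jn] := leqP n.+1 j.
    have := minj (j - n.+1)%N.
    rewrite (_ : (j - n.+1)%:Z - N%:Z = - n.+1%:Z + (j%:Z - N%:Z)); last lia.
    move=> /(_ (introT (asboolP _) Mn)); lia.
  have := low _ Mn; lia.
- move=> k M' M'M; rewrite rz_rinf_pow// => Mk.
  have := minM M'; move=> /(_ (introT (asboolP _) _))/wrap[].
    by exists (k + (j%:Z - N%:Z)).
  by rewrite leqNgt M'M.
Qed.

Lemma first_visit_fundamental (R : realType) (mu_inf : {measure set (Seq X) -> \bar R}) :
  {ae mu_inf, forall z, Xinf r z} ->
  {ae mu_inf, forall z, exists M, A M (z 0%N)} ->
  (forall M, {ae mu_inf, forall z, exists N, forall n, (N <= n)%N -> ~ A M (z n)}) ->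
  fundamental_domain r mu_inf first_visit.
Proof.
move=> aeX ae0 /ae_foralln aefar; split; first exact: measurable_first_visit.
split; first by move=> z [].
split.
  have := aeS2 ae0 aefar (fun z z0 zf => conj z0 zf); apply: negligibleS.
  move=> z [zX ncov] /= [z0 zfar]; apply: ncov.
  have [k kz] := first_visit_exists zX z0 zfar.
  by exists (- k) => //; split => //; rewrite opprK.
move=> n m nm; rewrite (_ : _ `&` _ = set0); first exact: negligible_set0.
apply/seteqP; split => // z [[zX nz] [_ mz]].
move: nm; suff /eqP : n - m = 0 by rewrite subr_eq0 => ->.
apply: (first_visit_unique nz); rewrite -rinf_powD//.
by rewrite (_ : n - m + - n = - m)//; lia.
Qed.

End FirstVisit.

(** * Backward orbits leave the levels of the cocycle sum *)

Section FundamentalDomain.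
Context d (X : measurableType d) (R : realType) (r : X -> X) (mu : probability X R).
Variables (m0 : X -> R[i]) (mu_inf : {measure set (Seq X) -> \bar R}).
Hypothesis mr : measurable_fun setT r.
Hypothesis r_finite : forall x, finite_set (fibre r x).
Hypothesis r_onto : forall x, exists y, r y = x.
Hypothesis mu_si : strongly_invariant r mu.
Hypothesis mm0 : cmeasurable setT m0.
Hypothesis m0_neq0 : {ae mu, forall x, m0 x <> 0}.
Hypothesis mu_infP : is_solenoid_measure r m0 mu mu_inf.
Local Notation h := (fun x => csq (m0 x)).

Definition cocycle_sum (x : X) : \bar R :=
  (\sum_(n <oo) (\prod_(0 <= k < n) h (iter k r x))%:E)%E.

Definition cocycle_level (M : nat) : set X := [set x | (cocycle_sum x <= M%:R%:E)%E].

Let h_ge0 n x : (0 <= (\prod_(0 <= k < n) h (iter k r x))%:E)%E.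
Proof. by rewrite lee_fin; apply: prodr_ge0 => j _; exact: csq_ge0. Qed.

Let measurable_term n : measurable_fun setT (fun x => (\prod_(0 <= k < n) h (iter k r x))%:E).
Proof.
apply/measurable_EFinP; apply: measurable_prod => j _.
by apply: measurableT_comp (cmeasurable_csq mm0) _; exact: measurable_iter.
Qed.

Lemma measurable_cocycle_level M : measurable (cocycle_level M).
Proof.
rewrite -[X in measurable X]setTI; apply: emeasurable_fun_infty_c => //.
by apply: ge0_emeasurable_sum => // n x _ _.
Qed.

Lemma ae_leave_level M :
  {ae mu_inf, forall z, exists N, forall n, (N <= n)%N -> ~ cocycle_level M (z n)}.
Proof.
pose F n := [set z : Seq X | cocycle_level M (z n)].
have mF n : measurable (F n).
  rewrite -[X in measurable X]setTI; apply: (measurable_coord n) => //.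
  exact: measurable_cocycle_level.
have mL : measurable [set z : Seq X | cocycle_level M (z 0%N)] by exact: (mF 0%N).
(* The [n]-th coordinate of r_infty^n(z) is z_0, so the change of variables by r_infty^n turns the
   condition on coordinate [n] into one on coordinate 0, weighted by the [n]-th density. *)
have FE n : mu_inf (F n) =
    (\int[mu_inf]_(z in F 0%N) (\prod_(0 <= k < n) h (iter k r (z 0%N)))%:E)%E.
  rewrite -integral_indicT//.
  rewrite -(@integral_rinf_pow _ _ _ _ mu m0 _ mr r_finite r_onto mu_si mm0 m0_neq0 mu_infP n)//.
  - rewrite [RHS]integral_mkcond epatch_indic; apply: eq_integral => z _.
    rewrite csq_mtilde_nat muleC; congr (_ * (nat_of_bool _)%:R%:E)%E.
    by apply/idP/idP; rewrite !inE /F /= iter_rinf ltnn subnn.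
  - exact/measurable_EFinP/measurable_indic.
have sumF : (\sum_(n <oo) mu_inf (F n) < +oo)%E.
  rewrite (eq_eseriesr (fun n _ => FE n)) -integral_nneseries//; last first.
    move=> n; apply: measurable_funTS; apply: measurableT_comp (measurable_term n) _.
    exact: measurable_coord.
  apply: (@le_lt_trans _ _ (\int[mu_inf]_(z in F 0%N) (cst (M%:R%:E) z))%E).
    apply: ge0_le_integral => //.
    + by move=> z _; apply: nneseries_ge0 => n _ _; exact: h_ge0.
    + apply: measurable_funTS; apply: ge0_emeasurable_sum => [n z _ _|n _]; first exact: h_ge0.
      by apply: measurableT_comp (measurable_term n) _; exact: measurable_coord.
  rewrite integral_cst//; apply: lte_mul_pinfty => //.
  exact: (@mu_inf_fin _ _ _ r mu m0).
exists (lim_sup_set F); split.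
- apply: bigcapT_measurable => n; apply: bigcup_measurable => j _; exact: mF.
- exact: lim_sup_set_cvg0.
- move=> z /= /forallNP nz n _.
  have /existsNP[j /not_implyP[nj /contrapT zj]] := nz n.
  by exists j.
Qed.

End FundamentalDomain.

(** The enumeration 0, -1, 1, -2, ... turns sums over the integers into series, to which exchange
    with the integral and tail estimates apply. *)
Definition nat_to_int (n : nat) : int := if odd n then Negz n./2 else Posz n./2.

Lemma nat_to_int_bij : set_bij [set: nat] [set: int] nat_to_int.
Proof.
split => //.
- move=> m n _ _; rewrite /nat_to_int => mn.
  rewrite -(odd_double_half m) -(odd_double_half n).
  by move: mn; case: (odd m); case: (odd n) => // -[->].
- move=> [n|n] _; [exists n.*2 | exists n.*2.+1] => //; rewrite /nat_to_int /=.
    by rewrite odd_double doubleK.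
  by rewrite odd_double uphalf_double.
Qed.

Lemma esum_int (R : realType) (a : int -> \bar R) : (forall k, 0 <= a k)%E ->
  (\esum_(k in [set: int]) a k = \sum_(j <oo) a (nat_to_int j))%E.
Proof.
by move=> a0; rewrite (@reindex_esum _ _ _ setT setT nat_to_int a nat_to_int_bij) nneseries_esumT.
Qed.

Lemma esum_single (R : realType) (T : choiceType) (a : T -> \bar R) (k : T) :
  (forall l, 0 <= a l)%E -> (forall l, l != k -> a l = 0%E) ->
  (\esum_(l in [set: T]) a l = a k)%E.
Proof.
move=> a0 ak; rewrite (esumID [set k])// setTI esum_set1// esum1 ?adde0//.
by move=> l [_ /eqP]; exact: ak.
Qed.

(** * The direct integral decomposition *)

Section Decomposition.
Context d (X : measurableType d) (R : realType) (r : X -> X) (mu : probability X R).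
Variables (m0 : X -> R[i]) (mu_inf : {measure set (Seq X) -> \bar R}).
Hypothesis mr : measurable_fun setT r.
Hypothesis r_finite : forall x, finite_set (fibre r x).
Hypothesis r_onto : forall x, exists y, r y = x.
Hypothesis mu_si : strongly_invariant r mu.
Hypothesis mm0 : cmeasurable setT m0.
Hypothesis m0_neq0 : {ae mu, forall x, m0 x <> 0}.
Hypothesis mu_infP : is_solenoid_measure r m0 mu mu_inf.
Hypothesis mXinf : measurable (Xinf r).
Variable F : set (Seq X).
Hypothesis mF : measurable F.
Hypothesis FX : F `<=` Xinf r.
Hypothesis F_unique : forall (k : int) z, F z -> F (rinf_pow r k z) -> k = 0.
Hypothesis F_cover : {ae mu_inf, forall z, exists k : int, F (rinf_pow r k z)}.
Local Notation T := (rinf_pow r).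

Let mT k : measurable_fun setT (T k).
Proof. exact: measurable_rinf_pow. Qed.

Let mTF k : measurable (T k @^-1` F).
Proof. by rewrite -[X in measurable X]setTI; exact: mT. Qed.

Let TK (k : int) z : Xinf r z -> T (- k) (T k z) = z.
Proof. by move=> zX; rewrite -rinf_powD// addNr. Qed.

Definition orbit_transform (xi : Seq X -> R[i]) : Seq X -> int -> R[i] :=
  fun z n => xi (T n z).

(** Change of variables makes the [k]-th term the integral of |xi|^2 over r_infty^k(F), and these
    translates tile the solenoid up to a null set. Both sides may be infinite; surjectivity uses
    this to deduce that a preimage is square integrable. *)
Lemma orbit_transform_isometry (xi : Seq X -> R[i]) : cmeasurable setT xi ->
  (\int[mu_inf]_(z in F) hnorm2 r m0 z (orbit_transform xi z) =
   \int[mu_inf]_s (csq (xi s))%:E)%E.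
Proof.
move=> /cmeasurable_csq mxi.
pose g (k : int) z := ((csq (xi (T k z)))%:E * (csq (mtilde r m0 k z))%:E)%E.
have g0 k z : (0 <= g k z)%E by rewrite mule_ge0// lee_fin csq_ge0.
have mg k : measurable_fun setT (g k).
  apply: emeasurable_funM; apply/measurable_EFinP.
    exact: measurableT_comp mxi (mT k).
  exact: measurable_csq_mtilde.
pose phi (k : int) z := ((\1_F (T (- k) z))%:E * (csq (xi z))%:E)%E.
have phi0 k z : (0 <= phi k z)%E by rewrite mule_ge0// lee_fin ?csq_ge0// indicE.
have mphi k : measurable_fun setT (phi k).
  apply: emeasurable_funM; last exact/measurable_EFinP.
  by apply/measurable_EFinP; exact: measurable_indic (mTF (- k)).
have gphi k : (\int[mu_inf]_(z in F) g k z = \int[mu_inf]_z phi k z)%E.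
  rewrite -(@integral_rinf_pow _ _ _ _ mu m0 _ mr r_finite r_onto mu_si mm0 m0_neq0 mu_infP k)//.
  rewrite integral_mkcond epatch_indic; apply: ae_eq_integral => //.
  - by apply: emeasurable_funM => //; exact/measurable_EFinP/measurable_indic.
  - apply: emeasurable_funM; first exact: measurableT_comp (mphi k) (mT k).
    by apply/measurable_EFinP; exact: measurable_csq_mtilde.
  - apply: (aeS (ae_Xinf mu_infP)) => z zX _; rewrite /phi /= TK// /g.
    by rewrite [LHS]muleC muleA.
transitivity (\int[mu_inf]_(z in F) \sum_(j <oo) g (nat_to_int j) z)%E.
  apply: eq_integral => z _; rewrite -(@esum_int _ (fun k => g k z))//.
rewrite integral_nneseries//; last by move=> j; exact: measurable_funTS.
under eq_eseriesr do rewrite gphi.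
rewrite -integral_nneseries//; apply: ae_eq_integral => //.
- by apply: ge0_emeasurable_sum => // j z _ _.
- exact/measurable_EFinP.
- apply: (aeS2 (ae_Xinf mu_infP) F_cover) => z zX [k kF] _.
  rewrite -(@esum_int _ (fun k => phi k z))// (@esum_single _ _ _ (- k))//.
    by rewrite /phi opprK indicE mem_set// mul1e.
  move=> l lk; rewrite /phi indicE memNset ?mul0e// => lF.
  move: lk; suff -> : l = - k by rewrite eqxx.
  have /eqP : - l - k = 0.
    by apply: (F_unique kF); rewrite -rinf_powD// subrK.
  by rewrite subr_eq0 => /eqP <-; rewrite opprK.
Qed.

Lemma orbit_transform_DI xi : L2 mu_inf xi -> DI r m0 mu_inf F (orbit_transform xi).
Proof.
move=> [[mRe mIm] xioo]; split; last by rewrite orbit_transform_isometry.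
move=> n; split; apply: measurable_funTS.
  exact: measurableT_comp mRe (mT n).
exact: measurableT_comp mIm (mT n).
Qed.

Lemma orbit_transform_onto eta : DI r m0 mu_inf F eta ->
  exists2 xi, L2 mu_inf xi & DIeq mu_inf F (orbit_transform xi) eta.
Proof.
move=> [meta etaoo].
(* The point [w] is the image under r_infty^(-k) of the representative [T k w] of its orbit in [F],
   so its value is the coordinate [- k] of [eta] there. Off the orbits that meet [F] the value is
   0. *)
pose xi w := if pselect (exists k : int, Xinf r w /\ F (T k w)) is left H then
  let k := projT1 (cid H) in eta (T k w) (- k) else 0.
have xiE k w : Xinf r w -> F (T k w) -> xi w = eta (T k w) (- k).
  move=> wX kF; rewrite /xi; case: pselect => [H|[]]; last by exists k.
  case: cid => l [_ lF] /=; suff -> : l = k by [].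
  have /eqP : l - k = 0 by apply: (F_unique kF); rewrite -rinf_powD// subrK.
  by rewrite subr_eq0 => /eqP.
have xi0 w : ~ (exists k : int, Xinf r w /\ F (T k w)) -> xi w = 0.
  by rewrite /xi; case: pselect.
pose D (k : int) := Xinf r `&` T k @^-1` F.
have mD k : measurable (D k) by exact: measurableI.
(* A countable measurable cover: on each [D k] the return time is the constant [k], so [xi] is there
   a composition of measurable maps, and on the remaining piece it is 0. *)
pose E (j : nat) := if j is j'.+1 then D (nat_to_int j') else ~` \bigcup_j D (nat_to_int j).
have mE j : measurable (E j).
  by case: j => [|j] /=; [apply: measurableC; exact: bigcupT_measurable|exact: mD].
have TE : [set: Seq X] = \bigcup_j E j.
  apply/seteqP; split => // z _.
  have [[j _ jz]|nz] := pselect ((\bigcup_j D (nat_to_int j)) z); first by exists j.+1.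
  by exists 0%N.
have mcomp (p : R[i] -> R) : (forall n, measurable_fun F (fun z => p (eta z n))) ->
    measurable_fun setT (fun w => p (xi w)).
  move=> mp; rewrite TE; apply/measurable_fun_bigcup => // -[|j].
    apply: (@eq_measurable_fun _ _ _ _ _ (cst (p 0))) => // w; rewrite inE => /= nw.
    rewrite /= xi0// => -[k kw]; apply: nw.
    have [_ _ surj] := nat_to_int_bij; have [j _ jk] := surj k I.
    by exists j => //; rewrite jk.
  apply: (@eq_measurable_fun _ _ _ _ _ (fun w => p (eta (T (nat_to_int j) w) (- nat_to_int j)))).
    by move=> w; rewrite inE => -[wX wF]; rewrite (xiE (nat_to_int j)).
  apply: (@measurable_comp _ _ _ _ _ _ F (fun z => p (eta z (- nat_to_int j)))) => //.
    by move=> _ [w [_ wF] <-].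
  exact: measurable_funTS (mT _).
have mxi : cmeasurable setT xi.
  by split; [apply: (mcomp (@complex.Re R))|apply: (mcomp (@complex.Im R))] => n; case: (meta n).
have TxiE z : F z -> orbit_transform xi z = eta z.
  move=> Fz; apply/funext => n; rewrite /orbit_transform.
  have zX := FX Fz; rewrite (xiE (- n)) ?TK ?opprK//.
  exact: Xinf_rinf_pow.
exists xi.
  split => //; rewrite -orbit_transform_isometry//.
  rewrite (eq_integral (fun z => hnorm2 r m0 z (eta z)))// => z; rewrite inE => Fz.
  by rewrite TxiE.
by apply: aeW => z Fz n; rewrite TxiE.
Qed.

Lemma orbit_transform_decomposes : decomposes r m0 mu_inf F orbit_transform.
Proof.
split; first exact: orbit_transform_DI.
split; first by move=> a xi zeta _ _; exact: aeW.
split; first by move=> xi [mxi _]; exact: orbit_transform_isometry.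
split; first exact: orbit_transform_onto.
split; last by move=> f xi _ _; exact: aeW.
move=> xi _; apply: aeW => z Fz n.
by rewrite /orbit_transform /Uop /Uz rinf_pow1//; exact: FX.
Qed.

End Decomposition.

(** * Irreducibility of the fibres *)

Section Irreducibility.
Context d (X : measurableType d) (R : realType) (r : X -> X) (m0 : X -> R[i]).
Variable z : Seq X.
Hypothesis m1 : forall x : X, measurable [set x].
Hypothesis m0_neq0 : forall k : int, m0 (rz r k z) <> 0.
Hypothesis rz_inj : injective (fun k : int => rz r k z).

Definition delta (n : int) (c : R[i]) : int -> R[i] := fun k => if k == n then c else 0.

Let term (xi : int -> R[i]) (k : int) : \bar R := (csq (xi k) * csq (mtilde r m0 k z))%:E.

Let term_ge0 xi k : (0 <= term xi k)%E.
Proof. by rewrite lee_fin mulr_ge0// csq_ge0. Qed.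

Lemma Hz_delta n c : Hz r m0 z (delta n c).
Proof.
rewrite /Hz /= /hnorm2 (@esum_single _ _ (term (delta n c)) n)//; first exact: ltry.
by move=> l ln; rewrite /term /delta (negbTE ln) csq0 mul0r.
Qed.

(** With [x] a base point of the orbit, this is the function whose image under [piz] is a coordinate
    projection, the base points being distinct. *)
Lemma indicator_bounded_cmeas (x : X) :
  bounded_cmeas (fun y => if y == x then (1 : R[i]) else 0).
Proof.
split; last first.
  by exists 1 => y; case: ifP => _; rewrite ?csq1 ?csq0.
split.
  apply: (@eq_measurable_fun _ _ _ _ _ (\1_[set x] : X -> R)); last exact: measurable_indic.
  move=> y _ /=; rewrite indicE; case: eqP => [->|yx]; first by rewrite mem_set.
  by rewrite memNset.
apply: (@eq_measurable_fun _ _ _ _ _ (cst (0 : R))) => //.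
by move=> y _ /=; case: ifP.
Qed.

Definition truncate (xi : int -> R[i]) (N : nat) : int -> R[i] :=
  fun k => \sum_(j < N) delta (nat_to_int j) (xi (nat_to_int j)) k.

Lemma truncateE xi N j :
  truncate xi N (nat_to_int j) = if (j < N)%N then xi (nat_to_int j) else 0.
Proof.
have inj : injective nat_to_int.
  by move=> a b; have [_ i _] := nat_to_int_bij; apply: i; rewrite inE.
case: ifP => jN.
  rewrite /truncate (bigD1 (Ordinal jN))//= big1 ?addr0; first by rewrite /delta eqxx.
  move=> i /eqP ij; rewrite /delta; case: eqP => // /inj ji.
  by exfalso; apply: ij; apply/val_inj.
rewrite /truncate big1// => i _; rewrite /delta; case: eqP => // /inj ji.
by move: jN; rewrite ji ltn_ord.
Qed.

Lemma truncate_approx xi (e : R) : Hz r m0 z xi -> 0 < e ->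
  exists N, (hnorm2 r m0 z (fun n => (xi n - truncate xi N n)%R) < e%:E)%E.
Proof.
rewrite /Hz /= /hnorm2 (@esum_int _ (term xi))// => xioo e0.
have tail0 := @nneseries_tail_cvg _ (fun j => term xi (nat_to_int j)) xpredT xioo
  (fun k _ => term_ge0 xi _).
have /fine_cvgP[fin /cvgr0Pnorm_lt/(_ _ e0) small] := tail0.
have [N [finN smallN]] : exists N, (\sum_(N <= k <oo) term xi (nat_to_int k))%E \is a fin_num /\
    `|fine (\sum_(N <= k <oo) term xi (nat_to_int k))%E| < e.
  by near \oo => N; exists N; split; near: N.
exists N; rewrite (@esum_int _ (term _))//.
rewrite (nneseries_split 0 N)// add0n big_nat big1 ?add0e; last first.
  by move=> j /= jN; rewrite /term truncateE jN subrr csq0 mul0r.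
rewrite [ltLHS](_ : _ = \sum_(N <= k <oo) term xi (nat_to_int k))%E.
  by rewrite -(fineK finN) lte_fin; exact: le_lt_trans (ler_norm _) smallN.
rewrite !(ereal_series _ N); apply: eq_eseriesr => j Nj.
by rewrite /term truncateE ltnNge Nj subr0.
Unshelve. all: by end_near. Qed.

Lemma irreducible_fibre_of_injective : irreducible_fibre r m0 z.
Proof.
move=> K KH K0 KD KZ Kcl KU Kpi.
have [[xi [Kxi [n xin]]]|none] := pselect (exists xi, K xi /\ exists n, xi n <> 0); last first.
  left => xi Kxi /=; apply/funext => n; apply: contrapT => xin.
  by apply: none; exists xi; split => //; exists n.
right.
have Kscale m c c' : c <> 0 -> K (delta m c) -> K (delta m c').
  move=> /eqP c0 /(KZ (c' / c)); congr K; apply/funext => k; rewrite /delta.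
  by case: ifP; rewrite ?mulr0// divfK.
have UE m c : Uz r m0 z (delta (m + 1) c) = delta m (m0 (rz r m z) * c).
  apply/funext => k; rewrite /Uz /delta (inj_eq (addIr 1)).
  by case: eqP => [->//|_]; rewrite mulr0.
have Kn : K (delta n 1).
  apply: (Kscale _ (xi n)) => //.
  have := Kpi _ _ (indicator_bounded_cmeas (rz r n z)) Kxi; congr K.
  apply/funext => k; rewrite /piz /delta (inj_eq rz_inj).
  by case: eqP => [->|_]; rewrite ?mul1r ?mul0r.
(* [Uz] lowers the index by one and multiplies by a non-zero value of [m0]. Moving up uses
   invariance under the inverse of [Uz], moving down invariance under [Uz]. *)
have up m : K (delta m 1) -> K (delta (m + 1) 1).
  move=> Km; apply/(KU _ (Hz_delta _ _)); rewrite UE mulr1.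
  by apply: Kscale Km; exact/eqP/oner_neq0.
have down m : K (delta (m + 1) 1) -> K (delta m 1).
  move/(KU _ (Hz_delta _ _)); rewrite UE mulr1; apply: Kscale; exact: m0_neq0.
have Kall m : K (delta m 1).
  have Kup (l : nat) : K (delta (n + l%:Z) 1).
    by elim: l => [|l IH]; [rewrite addr0|rewrite -addn1 PoszD addrA; exact: up].
  have Kdown (l : nat) : K (delta (n - l%:Z) 1).
    elim: l => [|l IH]; first by rewrite subr0.
    by apply: down; rewrite (_ : _ + 1 = n - l%:Z)//; lia.
  have [[l ->]|[l ->]] : (exists l : nat, m = n + l%:Z) \/ (exists l : nat, m = n - l%:Z).
  - have [nm|mn] := leP n m; [left; exists (absz (m - n)); lia|right; exists (absz (n - m)); lia].
  - exact: Kup.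
  - exact: Kdown.
move=> eta Heta; apply: Kcl => // e e0.
have [N HN] := truncate_approx Heta e0.
exists (truncate eta N) => //.
elim: N {HN} => [|N IH].
  by move: K0; congr K; apply/funext => k; rewrite /truncate big_ord0.
rewrite (_ : truncate eta N.+1 = fun k =>
    truncate eta N k + delta (nat_to_int N) (eta (nat_to_int N)) k); last first.
  by apply/funext => k; rewrite /truncate big_ord_recr.
apply: KD => //; apply: Kscale (Kall _); exact/eqP/oner_neq0.
Qed.

End Irreducibility.

(** * Aperiodicity *)

Section CountableSeparation.
Context d (X : measurableType d).
Variable V : nat -> set X.
Hypothesis mV : forall n, measurable (V n).
Hypothesis V_sep : forall x y, x <> y -> exists n, V n x /\ ~ V n y.

(** The set where [f] and [g] differ is a countable union over the separating sets. Measurability of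
    the solenoid, of the sets of periodic points and of singletons comes from here. *)
Lemma measurable_eq_fun d' (Y : measurableType d') (f g : Y -> X) :
  measurable_fun setT f -> measurable_fun setT g -> measurable [set y | f y = g y].
Proof.
move=> mf mg; rewrite -[X in measurable X]setCK; apply: measurableC.
rewrite (_ : ~` _ = \bigcup_n (f @^-1` V n `&` g @^-1` (~` V n))).
  apply: bigcupT_measurable => n; apply: measurableI; rewrite -[X in measurable X]setTI.
    exact: mf.
  by apply: mg => //; exact: measurableC.
apply/seteqP; split => [y /V_sep[n fg]|y [n _ [fy gy]] /= fg]; first by exists n.
by apply: gy; rewrite /= -fg.
Qed.

Lemma measurable_singleton (x : X) : measurable [set x].
Proof. exact: (@measurable_eq_fun _ _ id (cst x)). Qed.

Lemma measurable_Xinf (r : X -> X) : measurable_fun setT r -> measurable (Xinf r).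
Proof.
move=> mr; rewrite (_ : Xinf r = \bigcap_n [set s : Seq X | r (s n.+1) = s n]); last first.
  by apply/seteqP; split => [s sX n _|s sX n]; [exact: sX|exact: (sX n I)].
apply: bigcapT_measurable => n; apply: measurable_eq_fun; last exact: measurable_coord.
by apply: measurableT_comp mr _; exact: measurable_coord.
Qed.

Section Aperiodic.
Context (R : realType) (r : X -> X) (mu : probability X R) (m0 : X -> R[i]).
Hypothesis mr : measurable_fun setT r.
Hypothesis r_finite : forall x, finite_set (fibre r x).
Hypothesis r_onto : forall x, exists y, r y = x.
Hypothesis mu_si : strongly_invariant r mu.
Hypothesis m0_qmf : QMF r m0.
Hypothesis summable : {ae mu, forall x, (cocycle_sum r m0 x < +oo)%E}.

Let mu_inv A : measurable A -> mu (r @^-1` A) = mu A.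
Proof. exact: strongly_invariant_invariant. Qed.

Let ae_comp (P : X -> Prop) : {ae mu, forall x, P x} -> {ae mu, forall x, P (r x)}.
Proof.
move=> [N [mN N0 PN]]; exists (r @^-1` N); split.
- by rewrite -[X in measurable X]setTI; exact: mr.
- by rewrite mu_inv.
- by move=> z /= Pz; apply: PN.
Qed.

(* The fibre average of [1_P] is [1_P / Nfib], so strong invariance forces [Nfib = 1]
   on [P]; by the filter equation [|m0| = 1] along periodic orbits, where the
   cocycle sum therefore diverges. *)
Lemma ae_aperiodic (p : nat) : (0 < p)%N -> {ae mu, forall x, iter p r x <> x}.
Proof.
move=> p0; pose P := [set x | iter p r x = x].
have mP : measurable P.
  by apply: measurable_eq_fun => //; exact: measurable_iter.
have Pr x : P x -> P (r x) by move=> Px; rewrite /P /= -iterSr iterS Px.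
have Prpred x : P x -> exists y, P y /\ r y = x.
  move=> Px; exists (iter p.-1 r x); rewrite /P /= -iterS prednK//; split => //.
  by rewrite -iterD addnC iterD Px.
have avgP x : fibre_average r \1_P x = \1_P x / Nfib r x :> R.
  have [Px|nPx] := pselect (P x); last first.
    rewrite [RHS](_ : _ = 0); last by rewrite indicE memNset// mul0r.
    rewrite -[RHS](fibre_average_cst r_finite r_onto 0 x); apply: eq_fibre_average => y yx.
    by rewrite indicE memNset// => /Pr; rewrite yx.
  have [y [Py yx]] := Prpred x Px.
  (* A fibre over a point of [P] contains just one point of [P]: points of [P] with the same image
     agree after [p] steps, hence are equal. *)
  rewrite /fibre_average (fsbigD1 y)//= fsbig1; last first.
    move=> y' [y'x y'y]; rewrite indicE memNset// => Py'; apply: y'y.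
    rewrite /= -Py -Py' /P /= -(prednK p0) !iterSr.
    by rewrite yx (y'x : r y' = x).
  by rewrite addr0 !indicE !mem_set// mul1r mulr1.
have [||g [mg g0 gE gI]] := @fibre_average_ae_measurable _ _ _ _ r_finite r_onto _ mu_si \1_P.
- exact: measurable_indic.
- by move=> x; rewrite indicE.
have N1 x : 1 <= Nfib r x :> R.
  have [y yx] := r_onto x; rewrite /Nfib (fsbigD1 y)//= lerDl.
  by apply: fsumr_ge0.
(* The bound of [g] by the indicator of [P] holds only almost everywhere; the minimum makes it hold
   at every point, as the comparison of integrals requires. *)
have gle : {ae mu, forall x, Num.min (g x) (\1_P x) = g x}.
  apply: (aeS gE) => x <-; apply/min_idPl; rewrite avgP ler_pdivrMr ?(lt_le_trans _ (N1 x))//.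
  by rewrite ler_peMr// indicE.
have g1 : {ae mu, forall x, ((Num.min (g x) (\1_P x))%:E = (\1_P x : R)%:E)%E}.
  apply: ae_eq_of_le_integral.
  - apply/measurable_EFinP; apply: measurable_minr => //.
  - exact/measurable_EFinP/measurable_indic.
  - by move=> x; rewrite lee_fin le_min g0 indicE/=.
  - by move=> x; rewrite lee_fin ge_min lexx orbT.
  - by rewrite integral_indicT// -ge0_fin_numE//; exact: fin_num_measure.
  - rewrite -gI; apply: ae_eq_integral => //.
    + by apply/measurable_EFinP; apply: measurable_minr.
    + exact/measurable_EFinP.
    + by apply: (aeS gle) => x -> _.
have h1 : {ae mu, forall x, forall y, r y = x -> P y -> csq (m0 y) = 1}.
  apply: (aeS2 gE (aeS2 gle g1 (fun x a b => conj a b))) => x gx [gm [gP]] y yx Py.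
  have Px : P x by rewrite -yx; exact: Pr.
  have Nx : Nfib r x = 1 :> R.
    move: gP; rewrite gm -gx avgP indicE mem_set// mul1r => Nx.
    by rewrite -[LHS]invrK Nx invr1.
  have fx : fibre r x `\ y = set0.
    apply/seteqP; split => // w wx; have fin : finite_set (fibre r x `\ y).
      exact: finite_setD.
    move: Nx; rewrite /Nfib (fsbigD1 y)//= (fsbigD1 w)//=.
    set S := (X in _ + (_ + X)); have S0 : 0 <= S by apply: fsumr_ge0.
    lra.
  have := m0_qmf.2 x; rewrite Nx invr1 mul1r (fsbigD1 y)//= fx fsbig_set0.
  by rewrite addr0.
have h1' : {ae mu, forall x, P x -> csq (m0 x) = 1}.
  by apply: (aeS (ae_comp h1)) => x /(_ x erefl).
have h1n : {ae mu, forall x, forall n, P (iter n r x) -> csq (m0 (iter n r x)) = 1}.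
  apply: ae_foralln => n; elim: n => // n IH.
  by apply: (aeS (ae_comp IH)) => x; rewrite -iterSr.
apply: (aeS2 summable h1n) => x sx hx Px.
have Pn n : P (iter n r x) by elim: n => //= n; exact: Pr.
have Sge k : (k%:R%:E <= cocycle_sum r m0 x)%E.
  apply: le_trans (nneseries_lim_ge k _); last first.
    by move=> n _ _; rewrite lee_fin; apply: prodr_ge0 => j _; exact: csq_ge0.
  rewrite sumEFin lee_fin (eq_bigr (fun=> 1)) ?sumr_const_nat ?subn0// => n _.
  by rewrite big1// => j _; exact: hx.
have Sfin : cocycle_sum r m0 x \is a fin_num.
  by rewrite ge0_fin_numE//; exact: le_trans (Sge 0%N).
have := Sge (Num.truncn (fine (cocycle_sum r m0 x))).+1.
by rewrite -(fineK Sfin) lee_fin leNgt truncnS_gt.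
Qed.

(** A coincidence of base points at times a < b makes the one at time a periodic under [r] with
    period b - a. Almost no point is periodic, and by invariance of null sets this holds along the
    whole orbit. *)
Lemma ae_rz_injective (mu_inf : {measure set (Seq X) -> \bar R}) :
  {ae mu, forall x, m0 x <> 0} -> is_solenoid_measure r m0 mu mu_inf ->
  {ae mu_inf, forall z, injective (fun k : int => rz r k z)}.
Proof.
move=> m0_neq0 mu_infP; have mm0 := m0_qmf.1.
have ap : {ae mu, forall x, forall n, iter n.+1 r x <> x}.
  by apply: ae_foralln => n; exact: ae_aperiodic.
have apz := ae_rinf_pow mr r_finite r_onto mu_si mm0 m0_neq0 mu_infP (ae_theta0 mu_infP ap).
apply: (aeS2 (ae_Xinf mu_infP) apz) => z zX apx.
have lt_false (a b : int) : a < b -> rz r a z = rz r b z -> False.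
  move=> ab e; have [n bE] : exists n : nat, b = n.+1%:Z + a by exists (absz (b - a - 1)%R); lia.
  apply: (apx a n); move: e; rewrite bE -(rz_rinf_pow _ _ zX) rz_nat.
  by rewrite -[_ 0%N]/(rz r a z) => <-.
move=> a b e; have [ab|ba|//] := ltgtP a b; exfalso.
  exact: lt_false ab e.
exact: lt_false ba (esym e).
Qed.

End Aperiodic.
End CountableSeparation.

(** Compactness gives a countable basis, and the Hausdorff property lets a basic neighbourhood of
    one point exclude the other. *)
Lemma compact_countable_separation (R : realType) (X : pseudoPMetricType R) :
  compact [set: X] -> hausdorff_space X ->
  exists V : nat -> set (Borel X), (forall n, measurable (V n)) /\
    (forall x y, x <> y -> exists n, V n x /\ ~ V n y).
Proof.
move=> cX hX; have [B cB [Bopen Bbasis]] := compact_second_countable cX.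
have [g gB] := (pcard_surjP cB).
(* The enumeration [g] covers the basis but may take values outside it; those are replaced by the
   empty set. *)
exists (fun n => [set x | B (g n) /\ g n x]); split.
  move=> n; have [Bn|nBn] := pselect (B (g n)).
    rewrite (_ : [set _ | _] = g n); first by apply: sub_sigma_algebra; exact: Bopen.
    by apply/seteqP; split => [x []|x].
  by rewrite (_ : [set _ | _] = set0)//; apply/seteqP; split => [x []|x].
move=> x y /eqP xy; move: hX; rewrite open_hausdorff => /(_ x y xy)[[P Q]]/= [].
rewrite !inE => Px Qy [oP oQ PQ0].
have [U [BU Ux] UP] := Bbasis x P (open_nbhs_nbhs (conj oP Px)).
have [n _ gn] := gB U BU; exists n; rewrite gn; split => // -[_ Uy].
have : (P `&` Q) y by split => //; exact: UP.
by rewrite PQ0.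
Qed.

Unset Implicit Arguments.

Theorem theorem3p3 (R : realType) (X : pseudoPMetricType R)
  (r : Borel X -> Borel X) (mu : probability (Borel X) R) (m0 : Borel X -> R[i])
  (mu_inf : {measure set (Seq (Borel X)) -> \bar R}) :
  (* X is a compact metric space (pseudometric + Hausdorff), with its Borel sigma-algebra *)
  compact [set: X] -> hausdorff_space X ->
  (* r : X -> X is Borel measurable, finite-to-one and onto *)
  measurable_fun setT r ->
  (forall x, finite_set (fibre r x)) ->
  (forall x, exists y, r y = x) ->
  (* mu is a strongly invariant Borel probability measure, r is ergodic *)
  strongly_invariant r mu ->
  ergodic r mu ->
  (* m0 is a quadrature mirror filter with the stated properties *)
  QMF r m0 ->
  ~ {ae mu, forall x, Num.sqrt (csq (m0 x)) = 1} ->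
  mu [set x | m0 x = 0] = 0%E ->
  mu.-integrable setT (fun x => (ln (csq (m0 x)))%:E) ->
  (* mu_inf is the measure mu_infty on the solenoid X_infty *)
  is_solenoid_measure r m0 mu mu_inf ->
  exists F : set (Seq (Borel X)),
    fundamental_domain r mu_inf F /\
    (exists Psi, decomposes r m0 mu_inf F Psi) /\
    {ae mu_inf, forall z, F z -> irreducible_fibre r m0 z}.
Proof.
move=> cX hX mr r_finite r_onto mu_si mu_erg m0_qmf m0_ne1 m0_null lnm0 mu_infP.
have [V [mV V_sep]] := compact_countable_separation cX hX.
have mm0 := m0_qmf.1.
have mh : measurable_fun setT (fun x => csq (m0 x)) := cmeasurable_csq mm0.
have m0_neq0 : {ae mu, forall x, m0 x <> 0}.
  exists [set x | m0 x = 0]; split => //; last by move=> x /= /contrapT.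
  rewrite (_ : [set x | _] = (fun x => csq (m0 x)) @^-1` [set 0]).
    by rewrite -[X in measurable X]setTI; exact: mh.
  by apply/seteqP; split => x /= => [->|/csq_eq0//]; rewrite csq0.
have mu_inv A : measurable A -> mu (r @^-1` A) = mu A.
  exact: strongly_invariant_invariant.
(* The filter equation says that the fibre average of |m0|^2 is identically 1. As |m0|^2 may be
   unbounded, the extension of strong invariance to non-negative functions is used. *)
have h_int : (\int[mu]_x (csq (m0 x))%:E = 1)%E.
  have [g [mg g0 gE <-]] := fibre_average_ae_measurable r_finite r_onto mu_si mh
    (fun x => csq_ge0 (m0 x)).
  rewrite (ae_eq_integral (cst 1%E))//.
  - by rewrite integral_cst// mul1e; exact: probability_setT.
  - exact/measurable_EFinP.
  - by apply: (aeS gE) => x <- _; rewrite /fibre_average m0_qmf.2.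
have summable : {ae mu, forall x, (cocycle_sum r m0 x < +oo)%E}.
  apply: (cocycle_summable mr mu_inv mu_erg mh) => //.
  - by move=> x; exact: csq_ge0.
  - by apply: (aeS m0_neq0) => x m0x; rewrite lt_neqAle csq_ge0 andbT eq_sym; apply/eqP => /csq_eq0.
  - by move=> h1; apply: m0_ne1; apply: (aeS h1) => x ->; rewrite sqrtr1.
have mXinf := measurable_Xinf mV V_sep mr.
pose A := cocycle_level r m0.
have mA M : measurable (A M) by exact: measurable_cocycle_level.
have aeA : {ae mu_inf, forall z, exists M, A M (z 0%N)}.
  apply: (ae_theta0 mu_infP (P := fun x => exists M, A M x)).
  apply: (aeS summable) => x sx; have S0 : (0 <= cocycle_sum r m0 x)%E.
    by apply: nneseries_ge0 => n _ _; rewrite lee_fin; apply: prodr_ge0 => j _; exact: csq_ge0.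
  have sfin : cocycle_sum r m0 x \is a fin_num by rewrite ge0_fin_numE.
  exists (Num.truncn (fine (cocycle_sum r m0 x))).+1.
  by rewrite /A /cocycle_level /= -(fineK sfin) lee_fin ltW// truncnS_gt.
have aeFar M := ae_leave_level mr r_finite r_onto mu_si mm0 m0_neq0 mu_infP M.
exists (first_visit r A); split; last split.
- exact: first_visit_fundamental (ae_Xinf mu_infP) aeA aeFar.
- exists (orbit_transform r).
  apply: (orbit_transform_decomposes mr r_finite r_onto mu_si mm0 m0_neq0 mu_infP).
  + exact: mXinf.
  + exact: measurable_first_visit.
  + by move=> z [].
  + exact: first_visit_unique.
  + apply: (aeS2 (ae_Xinf mu_infP) (aeS2 aeA (ae_foralln aeFar) (fun z a b => conj a b))).
    by move=> z zX [zA zfar]; exact: first_visit_exists.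
- have inj := ae_rz_injective mV V_sep mr r_finite r_onto mu_si m0_qmf summable m0_neq0 mu_infP.
  have nz := ae_rz_neq0 mr r_finite r_onto mu_si mm0 m0_neq0 mu_infP.
  apply: (aeS2 inj nz) => z zinj znz _.
  by apply: irreducible_fibre_of_injective => // x; exact: measurable_singleton mV V_sep x.
Qed.
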